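(* Let $\Omega\in\mathcal{S}$ be taut, and let $\varphi:\Omega\to\Omega$ be holomorphic. If the operator $C_\varphi$ is hypercyclic, then it is hereditarily hypercyclic.
   Context: A Stein manifold is a complex analytic manifold $\Omega$ of finite dimension $N$ such that: $\Omega$ has an exhaustion by compact sets $K_l$ with $K_l\subset\operatorname{int}K_{l+1}$ and $\bigcup_l K_l=\Omega$; the holomorphic hull $\widehat{K}_\Omega=\{z\in\Omega: |f(z)|\le\sup_K|f| \text{ for every } f\in\mathcal{O}(\Omega)\}$ of every compact set $K\subset\Omega$ is compact; holomorphic functions on $\Omega$ separate points; and for each $z\in\Omega$ some holomorphic map $F:\Omega\to\mathbb{C}^N$ has invertible derivative at $z$. $\mathcal{O}(\Omega)$ is the space of holomorphic functions $\Omega\to\mathbb{C}$ with the topology of uniform convergence on compact sets. For holomorphic $\varphi:\Omega\to\Omega$, $C_\varphi:\mathcal{O}(\Omega)\to\mathcal{O}(\Omega)$ is $C_\varphi(f)=f\circ\varphi$. For a self-map $T$, $T^{[n]}$ denotes its $n$-th iterate. ''Increasing'' means strictly increasing. A sequence $(T_l)_l$ of continuous self-maps of a topological space $X$ is universal if there is $x\in X$ with $\{T_l(x): l\in\mathbb{N}\}$ dense in $X$; it is hereditarily universal if each of its subsequences is universal. A continuous linear operator $T$ on a topological vector space is hypercyclic (resp. hereditarily hypercyclic) with respect to an increasing sequence $(n_l)_l\subset\mathbb{N}$ if $(T^{[n_l]})_l$ is universal (resp. hereditarily universal); it is hypercyclic (resp. hereditarily hypercyclic) if this holds for the full sequence $n_l=l$.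 A domain $U\subset\Omega$ is a Runge domain with respect to $\Omega$ if every function in $\mathcal{O}(U)$ can be approximated locally uniformly on $U$ by functions from $\mathcal{O}(\Omega)$. $\mathcal{S}$ is the class of all connected Stein manifolds $\Omega$ such that for every holomorphic $\varphi:\Omega\to\Omega$ and every increasing sequence $(n_l)_l$ of natural numbers: if (c1) $\varphi$ is injective, (c2) $\varphi(\Omega)$ is a Runge domain with respect to $\Omega$, and (c3) the sequence $(\varphi^{[n_l]})_l$ is run-away, i.e. for every compact $K\subset\Omega$ there is $l$ with $\varphi^{[n_l]}(K)\cap K=\varnothing$, then $C_\varphi$ is hypercyclic with respect to $(n_l)_l$. Tautness: let $\mathbb{D}$ be the open unit disc and $\mathcal{O}(\mathbb{D},\Omega)$ the set of holomorphic maps $\mathbb{D}\to\Omega$. An $N$-dimensional Stein manifold $\Omega$ admits an injective regular proper holomorphic map $F:\Omega\to\mathbb{C}^{2N+1}$; $\mathcal{O}(\mathbb{D},\Omega)$ carries the topology in which $f_n\to f$ means $F\circ f_n\to F\circ f$ uniformly on compact sets (this does not depend on $F$). A sequence $(f_n)_n\subset\mathcal{O}(\mathbb{D},\Omega)$ is compactly divergent if for all compact $K\subset\mathbb{D}$, $L\subset\Omega$ there is $n_0$ with $f_n(K)\cap L=\varnothing$ for all $n\ge n_0$. $\Omega$ is taut if every sequence in $\mathcal{O}(\mathbb{D},\Omega)$ is compactly divergent or has a subsequence convergent in $\mathcal{O}(\mathbb{D},\Omega)$. *)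

(* Defs.v *)
From HB Require Import structures.
From mathcomp Require Import all_boot all_order all_algebra complex.
From mathcomp Require Import all_classical all_reals interval_inference topology.
From mathcomp Require Import normedtype landau derive.

Set Implicit Arguments.
Unset Strict Implicit.
Unset Printing Implicit Defensive.
Import Order.TTheory GRing.Theory Num.Theory.
Import numFieldNormedType.Exports.

Local Open Scope ring_scope.
Local Open Scope classical_set_scope.

(* R[i] viewed as an abstract numClosedFieldType, so that the topology and the
   normed module structure of numFieldTypes are inferred on it.  The norm of
   [Cplx R] takes its values in [Cplx R]; [modulus] is the R-valued modulus. *)
Definition Cplx (R : realType) : numClosedFieldType := R[i].

Definition modulus (R : realType) (z : Cplx R) : R := ComplexField.Normc.normc z.

Definition increasing (n : nat -> nat) := {homo n : i j / (i < j)%N}.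

(* [chart_map] and [chart_inv] are only meaningful on [chart_dom] and on its
   image respectively. *)
Record chart (R : realType) (N : nat) (M : topologicalType) := Chart {
  chart_dom : set M ;
  chart_map : M -> 'rV[Cplx R]_N ;
  chart_inv : 'rV[Cplx R]_N -> M }.

Definition is_chart (R : realType) N (M : topologicalType) (c : chart R N M) :=
  [/\ open (chart_dom c),
      open (chart_map c @` chart_dom c),
      {within chart_dom c, continuous (chart_map c)},
      {within chart_map c @` chart_dom c, continuous (chart_inv c)} &
      forall z, chart_dom c z -> chart_inv c (chart_map c z) = z].

(* [differentiable] is Frechet differentiability over the scalar field, here
   [Cplx R]; at every point of an open set it is holomorphy. *)
Definition compatible_charts (R : realType) N (M : topologicalType)
    (c c' : chart R N M) :=
  forall z, chart_dom c z -> chart_dom c' z ->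
    differentiable (chart_map c' \o chart_inv c) (chart_map c z).

Record complexManifold (R : realType) (N : nat) := ComplexManifold {
  mfd_space :> topologicalType ;
  atlas : set (chart R N mfd_space) ;
  mfd_hausdorff : hausdorff_space mfd_space ;
  atlas_chart : forall c, atlas c -> is_chart c ;
  atlas_cover : forall z, exists2 c, atlas c & chart_dom c z ;
  atlas_compatible : forall c c', atlas c -> atlas c' -> compatible_charts c c' }.

(* Elements of O(U), U open, are represented by functions defined on all of M
   and unconstrained outside U. *)
Definition holomorphic_on (R : realType) N (M : complexManifold R N)
    (V : normedModType (Cplx R)) (U : set M) (f : M -> V) :=
  forall c, atlas c -> forall z, U z -> chart_dom c z ->
    differentiable (f \o chart_inv c) (chart_map c z).

Definition holomorphic (R : realType) N (M : complexManifold R N)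
    (V : normedModType (Cplx R)) (f : M -> V) := holomorphic_on [set: M] f.

Definition holomorphic_map (R : realType) N N' (M : complexManifold R N)
    (M' : complexManifold R N') (f : M -> M') :=
  continuous f /\
  forall c c', atlas c -> atlas c' ->
    forall z, chart_dom c z -> chart_dom c' (f z) ->
      differentiable (chart_map c' \o f \o chart_inv c) (chart_map c z).

Definition disc (R : realType) : set (Cplx R) := [set z | modulus z < 1].
Arguments disc : clear implicits.

(* An element of O(D, M) is represented by a function on all of [Cplx R],
   unconstrained outside the unit disc. *)
Definition holomorphic_disc (R : realType) N (M : complexManifold R N)
    (f : Cplx R -> M) :=
  {within disc R, continuous f} /\
  forall c, atlas c -> forall z, disc R z -> chart_dom c (f z) ->
    differentiable (chart_map c \o f) z.

Definition holomorphic_hull (R : realType) N (M : complexManifold R N)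
    (K : set M) : set M :=
  [set z | forall f : M -> Cplx R, holomorphic f ->
     modulus (f z) <= sup [set modulus (f w) | w in K]].

Definition stein (R : realType) N (M : complexManifold R N) :=
  [/\ exists K : nat -> set M,
        [/\ forall l, compact (K l),
            forall l, K l `<=` interior (K l.+1) &
            \bigcup_l K l = [set: M]],
      forall K : set M, compact K -> compact (holomorphic_hull K),
      forall z w : M, z <> w ->
        exists2 f : M -> Cplx R, holomorphic f & f z <> f w &
      forall z : M, exists2 F : M -> 'rV[Cplx R]_N, holomorphic F &
        forall c, atlas c -> chart_dom c z ->
          bijective ('d (F \o chart_inv c) (chart_map c z))].

Definition domain (M : topologicalType) (U : set M) :=
  [/\ open U, connected U & U !=set0].

Definition runge_domain (R : realType) N (M : complexManifold R N)
    (U : set M) :=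
  domain U /\
  forall f : M -> Cplx R, holomorphic_on U f ->
    forall K, compact K -> K `<=` U -> forall eps : R, 0 < eps ->
      exists2 g : M -> Cplx R, holomorphic g &
        forall z, K z -> modulus (f z - g z) < eps.

Definition universal (X : topologicalType) (T : nat -> X -> X) :=
  exists x, dense (range (fun l => T l x)).

Definition hereditarily_universal (X : topologicalType) (T : nat -> X -> X) :=
  forall k, increasing k -> universal (fun l => T (k l)).

Definition hypercyclic_wrt (X : topologicalType) (T : X -> X) (n : nat -> nat) :=
  universal (fun l => iter (n l) T).

Definition hereditarily_hypercyclic_wrt (X : topologicalType) (T : X -> X)
    (n : nat -> nat) :=
  hereditarily_universal (fun l => iter (n l) T).

Definition hypercyclic (X : topologicalType) (T : X -> X) :=
  hypercyclic_wrt T id.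

Definition hereditarily_hypercyclic (X : topologicalType) (T : X -> X) :=
  hereditarily_hypercyclic_wrt T id.

(* Used as a type, this set carries the topology induced by that of uniform
   convergence on compact sets. *)
Definition hol_space (R : realType) N (M : complexManifold R N) :
    set {family compact, M -> Cplx R} :=
  [set f | holomorphic (f : M -> Cplx R)].
Arguments hol_space {R N} M.

Lemma differentiable_near_eq (K : numFieldType) (V W : normedModType K)
    (f g : V -> W) (x : V) :
  (\near x, f x = g x) -> differentiable f x -> differentiable g x.
Proof.
move=> fg df.
have dfc : continuous ('d f x) by case/diff_locallyP : df.
have fgx : f x = g x by exact: nbhs_singleton fg.
have Dg : g \o shift x = cst (g x) + 'd f x +o_ 0 id.
  apply/eqaddoP => _/posnumP[e].
  have /diff_locallyP[_ /eqaddoP /(_ e%:num (ltac:(done))) H] := df.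
  have fg' : \forall h \near (0 : V), f (h + x) = g (h + x).
    move: fg; rewrite (near_shift 0 x) => fg.
    apply: filterS fg => h /=; by rewrite subr0.
  apply: filterS2 H fg' => h + fgh.
  by rewrite /= !fctE /= -fgh -fgx.
apply/diff_locallyP; rewrite (diff_unique dfc Dg).
by split.
Qed.

Lemma holomorphic_comp (R : realType) N N' (M : complexManifold R N)
    (M' : complexManifold R N') (V : normedModType (Cplx R))
    (phi : M -> M') (f : M' -> V) :
  holomorphic_map phi -> holomorphic f -> holomorphic (f \o phi).
Proof.
move=> [cphi dphi] hf c ac z _ cz.
have [c' ac' c'z] := atlas_cover (phi z).
have [odom oimg cmap cinv cK] := atlas_chart ac.
have [odom' _ _ _ cK'] := atlas_chart ac'.
have zimg : (chart_map c @` chart_dom c) (chart_map c z) by exists z.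
have cinvz : {for chart_map c z, continuous (chart_inv c)}.
  by move: cinv; rewrite continuous_open_subspace// => /(_ _ (mem_set zimg)).
apply: (@differentiable_near_eq _ _ _
  ((f \o chart_inv c') \o (chart_map c' \o phi \o chart_inv c))).
  have : \forall y \near chart_map c z, chart_dom c' (phi (chart_inv c y)).
    apply: (cinvz (phi @^-1` chart_dom c')).
    rewrite cK//; apply: cphi; exact: open_nbhs_nbhs.
  by apply: filterS => y /= /cK' ->.
apply: differentiable_comp; first exact: dphi.
by rewrite /= cK //; apply: hf.
Qed.

Definition comp_op (R : realType) N (M : complexManifold R N) (phi : M -> M)
    (hphi : holomorphic_map phi) (f : hol_space M) : hol_space M :=
  exist _ (set_val f \o phi : {family compact, M -> Cplx R})
    (mem_set (holomorphic_comp hphi (set_mem (valP f)))).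

Lemma comp_op_continuous (R : realType) N (M : complexManifold R N)
    (phi : M -> M) (hphi : holomorphic_map phi) : continuous (comp_op hphi).
Proof.
apply: continuous_comp_initial => f.
have FN : Filter (nbhs f) by exact: nbhs_filter.
have FF : Filter ((set_val \o comp_op hphi) @ f).
  exact: (@fmap_filter _ _ _ _ FN).
apply/(@fam_cvgP _ _ _ _ _ FF).
move=> K cK P /uniform_nbhs[E [entE EP]].
have cpK : compact (phi @` K).
  apply: continuous_compact => //; apply: continuous_subspaceT.
  exact: hphi.1.
have H : {family compact, (set_val @ f) --> (set_val f)}.
  exact: (@initial_continuous _ _ (@set_val _ (hol_space M))).
have {}H := (@fam_cvgP _ _ _ _ _ (@fmap_filter _ _ _ _ FN)).1 H _ cpK.
have : nbhs (set_val f : {uniform` phi @` K -> Cplx R})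
    [set h | forall y, (phi @` K) y -> E (set_val f y, h y)].
  by apply/uniform_nbhs; exists E; split.
move=> /H; apply: (@filterS _ _ FN) => g Hg; apply: EP => y Ky.
by apply: Hg; exists y.
Qed.

Definition run_away (M : topologicalType) (psi : nat -> M -> M) :=
  forall K : set M, compact K -> exists l, (psi l @` K) `&` K = set0.

Definition class_S (R : realType) N (M : complexManifold R N) :=
  [/\ stein M, connected [set: M] &
      forall (phi : M -> M) (hphi : holomorphic_map phi) (n : nat -> nat),
        increasing n ->
        injective phi ->
        runge_domain (range phi) ->
        run_away (fun l => iter (n l) phi) ->
        hypercyclic_wrt (comp_op hphi) n].

Definition regular (R : realType) N (M : complexManifold R N)
    (V : normedModType (Cplx R)) (F : M -> V) :=
  forall c, atlas c -> forall z, chart_dom c z ->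
    injective ('d (F \o chart_inv c) (chart_map c z)).

Definition proper_embedding (R : realType) N (M : complexManifold R N)
    (V : normedModType (Cplx R)) (F : M -> V) :=
  [/\ holomorphic F, injective F, regular F &
      forall L : set V, compact L -> compact (F @^-1` L)].

(* Every Stein manifold of dimension N admits such an F, and the notion does
   not depend on the choice of F. *)
Definition disc_cvg (R : realType) N (M : complexManifold R N)
    (u : nat -> Cplx R -> M) (f : Cplx R -> M) :=
  exists2 F : M -> 'rV[Cplx R]_(2 * N + 1)%N, proper_embedding F &
    forall K, compact K -> K `<=` disc R ->
      {uniform K, (fun n => F \o u n) @ \oo --> F \o f}.

Definition compactly_divergent (R : realType) N (M : complexManifold R N)
    (u : nat -> Cplx R -> M) :=
  forall (K : set (Cplx R)) (L : set M), compact K -> K `<=` disc R ->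
    compact L ->
    exists n0, forall n, (n0 <= n)%N -> (u n @` K) `&` L = set0.

Definition taut (R : realType) N (M : complexManifold R N) :=
  forall u : nat -> Cplx R -> M, (forall n, holomorphic_disc (u n)) ->
    compactly_divergent u \/
    exists k f, [/\ increasing k, holomorphic_disc f & disc_cvg (u \o k) f].

(* Main.v *)
(** Fix [phi] with [C_phi] hypercyclic.  Applying density of an orbit to [g] and
    to a small translate of [g] shows that [C_phi] has dense range.  Hence [phi]
    is injective because [O(Omega)] separates points, and [d phi] is injective
    by Cauchy's estimate: if [d phi v = 0] then every [h \o phi] has derivative
    [0] along [v], whereas the Stein condition provides [g] with a nonzero one.
    So [phi] is open, and dense range turns into the Runge property of its image.
    Approximating a large constant shows that the sequence of iterates runs away.

    It remains to see that every subsequence of the iterates runs away, which is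
    where tautness enters: applied to the discs [lambda |-> phi^q (y + lambda v)]
    in a chart, it shows that [phi^(q_i) (y_i) --> w] with [y_i --> y] forces
    [w] to be an omega-limit point of [y].  If some subsequence did not run away,
    this would give a point [w] that is an omega-limit point of itself and of
    every point of its orbit closure; such a [w] returns to a compact
    neighbourhood [V] of itself within bounded time, so its orbit lies in the
    compact set [\bigcup_(i <= N) phi^i(V)], which contradicts run-away. *)

Require Import Defs.
From mathcomp Require Import all_boot all_order all_algebra complex.
From mathcomp Require Import all_classical all_reals interval_inference topology.
From mathcomp Require Import normedtype landau derive.
From mathcomp Require Import ring lra zify.
Import Order.TTheory GRing.Theory Num.Theory.
Import numFieldNormedType.Exports.

Set Implicit Arguments.
Unset Strict Implicit.
Unset Printing Implicit Defensive.

Local Open Scope ring_scope.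
Local Open Scope classical_set_scope.

(** * Complex numbers *)

Lemma near_dist_lt (K : numFieldType) (V : normedModType K) (x : V) (e : K) :
  0 < e -> \forall y \near x, `|x - y| < e.
Proof. by move=> e0; apply/nbhs_normP; exists e. Qed.

Section cplx_facts.
Variable R : realType.
Local Notation C := (Cplx R).

Definition of_real (x : R) : C := x%:C%C.

Lemma norm_of_real (z : C) : `|z| = of_real (modulus z).
Proof. by []. Qed.

Lemma of_realD x y : of_real (x + y) = of_real x + of_real y.
Proof. exact: (rmorphD (real_complex R)). Qed.
Lemma of_realM x y : of_real (x * y) = of_real x * of_real y.
Proof. exact: (rmorphM (real_complex R)). Qed.

Lemma ler_of_real x y : (of_real x <= of_real y) = (x <= y).
Proof. by rewrite /of_real lecR. Qed.
Lemma ltr_of_real x y : (of_real x < of_real y) = (x < y).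
Proof. by rewrite /of_real ltcR. Qed.

Lemma gt0_of_real (e : C) : 0 < e -> exists2 d : R, 0 < d & e = of_real d.
Proof.
move=> e0; exists (modulus e).
  by rewrite -ltr_of_real -norm_of_real normr_gt0 gt_eqF.
by rewrite -norm_of_real gtr0_norm.
Qed.

Lemma of_real_continuous : continuous of_real.
Proof.
move=> x; apply/cvgrPdist_lt => e e0; have [d d0 ->] := gt0_of_real e0.
near=> y.
rewrite norm_of_real ltr_of_real.
have -> : of_real x - of_real y = of_real (x - y).
  by rewrite of_realD /of_real rmorphN.
have -> : modulus (of_real (x - y)) = `|x - y|.
  by rewrite /modulus/= expr0n/= addr0 sqrtr_sqr.
by near: y; apply: cvgr_dist_lt.
Unshelve. all: end_near. Qed.

Lemma of_realN x : of_real (- x) = - of_real x.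
Proof. exact: (rmorphN (real_complex R)). Qed.

Lemma of_realV x : of_real (x^-1) = (of_real x)^-1.
Proof. exact: (fmorphV (real_complex R)). Qed.

Lemma of_real_nat n : of_real n%:R = n%:R.
Proof. exact: (rmorph_nat (real_complex R)). Qed.

Lemma modulus_of_real x : modulus (of_real x) = `|x|.
Proof. by rewrite /modulus/= expr0n/= addr0 sqrtr_sqr. Qed.

Lemma of_real_ge0 (x : C) : 0 <= x -> of_real (modulus x) = x.
Proof. by move=> x0; rewrite -norm_of_real ger0_norm. Qed.

Lemma near_distC_lt (x e : C) : 0 < e -> \forall y \near x, `|x - y| < e.
Proof. exact: near_dist_lt. Qed.

Lemma modulus_dist_continuous (a : C) :
  continuous (fun z : C => modulus (z - a)).
Proof.
move=> x; have FF : Filter (nbhs x) by exact: nbhs_filter.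
apply/(@cvgrPdist_lt _ _ _ _ FF) => e e0; near=> y.
rewrite -ltr_of_real -[X in of_real X]modulus_of_real -norm_of_real of_realD of_realN.
rewrite -!norm_of_real; apply: le_lt_trans (ler_dist_dist _ _) _.
rewrite opprB addrA subrK.
by near: y; apply: near_distC_lt; rewrite (ltr_of_real 0).
Unshelve. all: end_near. Qed.

Lemma modulus_continuous : continuous (@modulus R).
Proof.
have -> : @modulus R = (fun z => modulus (z - 0)).
  by apply/funext => z; rewrite subr0.
exact: modulus_dist_continuous.
Qed.

Lemma exists_invS_lt (e : C) : 0 < e -> exists n : nat, n.+1%:R^-1 < e.
Proof.
move=> /gt0_of_real[d d0 ->]; exists (Num.truncn d^-1).
rewrite -[X in X < _]gtr0_norm ?invr_gt0 ?ltr0n// normrV ?unitfE ?pnatr_eq0//.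
rewrite normr_nat.
have -> : (Num.truncn d^-1).+1%:R^-1 = of_real (Num.truncn d^-1).+1%:R^-1 :> C.
  by rewrite of_realV of_real_nat.
rewrite ltr_of_real invf_plt ?posrE ?ltr0n//.
exact: truncnS_gt.
Qed.

(** Closed square with corner [a] and complex side vector [s]. As a continuous image of the real
    unit square it is compact at once. *)
Definition square (a s : C) : set C :=
  (fun p : R * R => a + (of_real p.1 + 'i * of_real p.2) * s) @`
    (`[0, 1]%classic `*` `[0, 1]%classic).

Lemma square_compact a s : compact (square a s).
Proof.
apply: continuous_compact; last first.
  by apply: compact_setX; exact: segment_compact.
apply: continuous_subspaceT => p.
apply: cvgD; first exact: cvg_cst.
apply: cvgM; last exact: cvg_cst.
apply: cvgD.
  by apply: (continuous_comp (@cvg_fst _ _ _ _ _)); exact: of_real_continuous.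
apply: cvgM; first exact: cvg_cst.
by apply: (continuous_comp (@cvg_snd _ _ _ _ _)); exact: of_real_continuous.
Qed.

Lemma cplxE (z : C) : z = of_real (complex.Re z) + 'i * of_real (complex.Im z).
Proof.
case: z => x y; rewrite /of_real.
have -> : 'i = 'i%C :> C by rewrite complexiE.
apply/eqP; rewrite eq_complex /=.
by rewrite !(mul0r, mul1r, mulr0, subr0, addr0, add0r) !eqxx.
Qed.

Lemma norm_Re_le (z : C) : `|complex.Re z| <= modulus z.
Proof. by rewrite -ler_of_real -norm_of_real; exact: normc_ge_Re. Qed.

Lemma norm_Im_le (z : C) : `|complex.Im z| <= modulus z.
Proof.
case: z => x y; rewrite /modulus /=.
by rewrite -[`|y|]sqrtr_sqr ler_sqrt ?addr_ge0 ?sqr_ge0// lerDr sqr_ge0.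
Qed.

(** Real and imaginary parts are bounded by the modulus, so the disc is a closed subset of a compact
    square. *)
Lemma closed_disc_compact (a r : C) : compact [set z : C | `|z - a| <= r].
Proof.
have [r0|/negP r0] := boolP (0 <= r); last first.
  rewrite (_ : [set _ | _] = set0); first exact: compact0.
  by rewrite -subset0 => z /= /(le_trans (normr_ge0 _)).
set d := modulus r; have rd : r = of_real d by rewrite of_real_ge0.
have d0 : 0 <= d by rewrite -ler_of_real -rd.
have -> : [set z : C | `|z - a| <= r] =
    (fun z => modulus (z - a)) @^-1` [set x | x <= d].
  by apply/seteqP; split => z /=; rewrite norm_of_real rd ler_of_real.
(* Half-side [d + 1] rather than [d] keeps the square nondegenerate when [d = 0], since its
   parameters are found by dividing by the side. *)
apply: (subclosed_compact _
  (@square_compact (a - of_real (d + 1) - 'i * of_real (d + 1))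
     (of_real (2 * (d + 1))))).
  apply: preimage_closed; last exact: closed_le.
  by move=> z _; exact: modulus_dist_continuous.
move=> z /= zr.
have := norm_Re_le (z - a); have := norm_Im_le (z - a).
set x := complex.Re _; set y := complex.Im _.
rewrite !ler_norml => /andP[y1 y2] /andP[x1 x2].
exists ((x + (d + 1)) / (2 * (d + 1)), (y + (d + 1)) / (2 * (d + 1))).
  split; rewrite /= in_itv /=; apply/andP; split;
    rewrite ?ler_pdivrMr ?ler_pdivlMr; lra.
have D0 : 2 * (d + 1) != 0 by rewrite gt_eqF//; lra.
rewrite /= mulrDl -mulrA -!of_realM !divfK//.
rewrite !of_realD mulrDr.
have -> : z = a + (of_real x + 'i * of_real y).
  by rewrite -cplxE addrC subrK.
ring.
Qed.

(** The norm of row vectors is the maximum norm, so the ball is a product of closed discs. *)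
Lemma rV_closed_ball_compact N (a : 'rV[C]_N) (r : C) : 0 <= r ->
  compact [set z : 'rV[C]_N | `|z - a| <= r].
Proof.
move=> r0.
have -> : [set z : 'rV[C]_N | `|z - a| <= r] =
    [set v : 'rV[C]_N | forall i, [set z : C | `|z - a ord0 i| <= r] (v ord0 i)].
  move: r0 => /nonnegP[{}r].
  apply/seteqP; split => v /=; rewrite [leLHS]/Num.norm /= mx_normE num_le.
    by move=> /bigmax_leP[_ H] i; have := H (ord0, i) isT; rewrite -num_le /= !mxE.
  move=> H; apply/bigmax_leP; split; first by rewrite -num_le /=; exact: ge0.
  by move=> -[i j] _; rewrite -num_le /= !mxE ord1; exact: H.
by apply: (@rV_compact C N (fun i => [set z : C | `|z - a ord0 i| <= r])) => i;
  exact: closed_disc_compact.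
Qed.

End cplx_facts.

(** * Riemann sums over squares and Goursat's lemma *)

Section goursat.
Variable R : realType.
Local Notation C := (Cplx R).
Implicit Types (f g : C -> C) (a v s z : C).

(* Midpoint Riemann sum of [f] with [3 ^ n] nodes over the segment from [a] to
   [a + v].  The midpoint rule is exact on affine functions; subdividing in three
   keeps a square centred at 0 centred at 0 (see [punctured_square_rsum]). *)
Fixpoint rsum f n a v : C :=
  if n is m.+1 then
    rsum f m a (v / 3) + rsum f m (a + v / 3) (v / 3) +
    rsum f m (a + v / 3 + v / 3) (v / 3)
  else f (a + v / 2) * v.

(** Discrete contour integral along the boundary, counterclockwise: bottom and right sides, minus
    top and left sides. *)
Definition square_rsum f n a s : C :=
  rsum f n a s + rsum f n (a + s) ('i * s) - rsum f n (a + 'i * s) s -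
  rsum f n a ('i * s).

Definition node a h (j k : nat) : C := a + j%:R * h + k%:R * ('i * h).

Lemma ler_normD_le (x y c d : C) : `|x| <= c -> `|y| <= d -> `|x + y| <= c + d.
Proof. by move=> xc yd; apply: le_trans (ler_normD _ _) _; exact: lerD. Qed.

(** Contributions of the interior edges of the 3 by 3 grid cancel. The identity is exact because
    [rsum] at level [n.+1] is by definition three sums at level [n]. The central square is set
    apart, as it will contain the singularity. *)
Lemma square_rsumS f n a s
    (I := fun j k => square_rsum f n (node a (s / 3) j k) (s / 3)) :
  square_rsum f n.+1 a s =
  I 1%N 1%N + (I 0%N 0%N + I 0%N 1%N + I 0%N 2%N + I 1%N 0%N + I 1%N 2%N +
   I 2%N 0%N + I 2%N 1%N + I 2%N 2%N).
Proof.
rewrite {}/I /square_rsum /=.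
set h := s / 3.
pose H j k := rsum f n (node a h j k) h.
pose V j k := rsum f n (node a h j k) ('i * h).
have ih : 'i * s / 3 = 'i * h by rewrite /h mulrA.
have sh : s = h + h + h by rewrite /h; field.
rewrite !ih.
have nodeH j k : node a h j k + h = node a h j.+1 k.
  by rewrite /node -natr1; ring.
have nodeV j k : node a h j k + 'i * h = node a h j k.+1.
  by rewrite /node -natr1; ring.
have a00 : a = node a h 0 0 by rewrite /node !mul0r !addr0.
have a30 : a + s = node a h 3 0 by rewrite /node [in LHS]sh; ring.
have a03 : a + 'i * s = node a h 0 3 by rewrite /node [in LHS]sh; ring.
have a10 : a + h = node a h 1 0 by rewrite /node; ring.
have a01 : a + 'i * h = node a h 0 1 by rewrite /node; ring.
rewrite a30 a03 a10 a01 !nodeH !nodeV.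
have -> : rsum f n a h = H 0%N 0%N by rewrite /H -a00.
have -> : rsum f n a ('i * h) = V 0%N 0%N by rewrite /V -a00.
by rewrite /H /V; ring.
Qed.

(** In the order of [C], [0 <= t <= 1] forces [t] to be real, so [a + t * v] runs over the
    segment. *)
Lemma rsum_bound f n a v (M : C) :
  (forall t : C, 0 <= t <= 1 -> `|f (a + t * v)| <= M) ->
  `|rsum f n a v| <= M * `|v|.
Proof.
elim: n a v => [|n IH] a v fM /=.
  rewrite normrM ler_wpM2r//.
  have := fM 2^-1; rewrite mulrC; apply.
  by rewrite invr_ge0 ler0n invf_le1// ?ler1n.
have sub (x : C) : 0 <= x -> x <= 2 -> forall t : C, 0 <= t <= 1 ->
    `|f (a + x * (v / 3) + t * (v / 3))| <= M.
  move=> x0 x2 t /andP[t0 t1].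
  have -> : a + x * (v / 3) + t * (v / 3) = a + (x + t) / 3 * v by field.
  apply: fM; rewrite divr_ge0 ?addr_ge0// ler_pdivrMr// mul1r.
  have -> : 3 = 2 + 1 :> C by ring.
  exact: lerD.
have vE : M * `|v| = M * `|v / 3| + M * `|v / 3| + M * `|v / 3|.
  by rewrite normrM normfV normr_nat; field.
rewrite vE; apply: le_trans (ler_normD _ _) _; apply: lerD; last first.
  apply: IH => t t01; have := sub 2 _ _ t t01.
  by rewrite mulrDl mul1r addrA => ->.
apply: le_trans (ler_normD _ _) _; apply: lerD.
  apply: IH => t t01; have := sub 0 _ _ t t01.
  by rewrite mul0r addr0 => ->.
apply: IH => t t01; have := sub 1 _ _ t t01.
by rewrite mul1r => ->//; rewrite ler1n.
Qed.

Lemma rsum_affine (al be : C) n a v :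
  rsum (fun z => al + be * z) n a v = (al + be * (a + v / 2)) * v.
Proof.
elim: n a v => [//|n IH] a v /=; rewrite !IH.
by field.
Qed.

Lemma rsumD f g n a v :
  rsum (fun z => f z + g z) n a v = rsum f n a v + rsum g n a v.
Proof. by elim: n a v => [|n IH] a v /=; rewrite ?mulrDl// !IH; ring. Qed.

Lemma square_rsumD f g n a s :
  square_rsum (fun z => f z + g z) n a s =
  square_rsum f n a s + square_rsum g n a s.
Proof. by rewrite /square_rsum !rsumD; ring. Qed.

Lemma square_rsum_affine al be n a s :
  square_rsum (fun z => al + be * z) n a s = 0.
Proof. by rewrite /square_rsum !rsum_affine; ring. Qed.

Lemma square_rsum_bound f n a s (M : C) :
  (forall t : C, 0 <= t <= 1 -> [/\ `|f (a + t * s)| <= M,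
     `|f (a + s + t * ('i * s))| <= M,
     `|f (a + 'i * s + t * s)| <= M & `|f (a + t * ('i * s))| <= M]) ->
  `|square_rsum f n a s| <= 4 * M * `|s|.
Proof.
move=> fM.
have is_ : `|'i * s| = `|s| by rewrite normrM normCi mul1r.
have -> : 4 * M * `|s| = M * `|s| + M * `|'i * s| + M * `|s| + M * `|'i * s|.
  by rewrite is_; ring.
rewrite /square_rsum.
apply: le_trans (ler_normB _ _) _; apply: lerD; last first.
  by apply: rsum_bound => t /fM[].
apply: le_trans (ler_normB _ _) _; apply: lerD; last first.
  by apply: rsum_bound => t /fM[].
by apply: le_trans (ler_normD _ _) _; apply: lerD;
  apply: rsum_bound => t /fM[].
Qed.

Definition cderiv f z (b : C) := forall e : C, 0 < e ->
  \forall w \near z, `|f w - f z - b * (w - z)| <= e * `|w - z|.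

Lemma cderiv_diff f z : differentiable f z -> exists b, cderiv f z b.
Proof.
move=> df; exists ('d f z 1) => e e0.
have /diff_locallyP[_ /eqaddoP /(_ e e0) H] := df.
rewrite (near_shift 0 z); apply: filterS H => h /=.
rewrite !fctE /= subr0 opprD addrA -addrA addrK.
suff -> : 'd f z h = 'd f z 1 * h by rewrite addrA.
by rewrite -[in LHS](mulr1 h) linearZ/= mulrC.
Qed.

Lemma in01P (x : R) : `[0, 1]%classic x <-> 0 <= x <= 1.
Proof. by rewrite /= in_itv. Qed.

Lemma square_corner a s : square a s a.
Proof.
exists (0, 0); first by split; rewrite /= in_itv /= lexx ler01.
by rewrite /= mulr0 addr0 mul0r addr0.
Qed.

Lemma of_real01 (t : C) :
  0 <= t <= 1 -> exists2 x : R, `[0, 1]%classic x & t = of_real x.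
Proof.
move=> /andP[t0 t1]; exists (modulus t); last by rewrite of_real_ge0.
by rewrite /= in_itv /= -!ler_of_real of_real_ge0// t0.
Qed.

Lemma square_edges a s (t : C) : 0 <= t <= 1 ->
  [/\ square a s (a + t * s), square a s (a + s + t * ('i * s)),
      square a s (a + 'i * s + t * s) & square a s (a + t * ('i * s))].
Proof.
move=> /of_real01[x x01 ->].
have i0 : `[0, 1]%classic (0 : R) by rewrite /= in_itv /= lexx ler01.
have i1 : `[0, 1]%classic (1 : R) by rewrite /= in_itv /= lexx ler01.
split; [exists (x, 0) => //| exists (1, x) => //|
  exists (x, 1) => //|exists (0, x) => //] => /=;
  rewrite -?[of_real 0]/(0 : C) -?[of_real 1]/(1 : C); ring.
Qed.

Lemma square_dist a s z w : square a s z -> square a s w -> `|z - w| <= 2 * `|s|.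
Proof.
move=> [[x y]/= [/in01P/andP[x0 x1] /in01P/andP[y0 y1]] <-].
move=> [[x' y']/= [/in01P/andP[x'0 x'1] /in01P/andP[y'0 y'1]] <-].
have -> : a + (of_real x + 'i * of_real y) * s -
    (a + (of_real x' + 'i * of_real y') * s) =
    (of_real (x - x') + 'i * of_real (y - y')) * s.
  by rewrite !of_realD !of_realN; ring.
rewrite normrM ler_wpM2r//; apply: le_trans (ler_normD _ _) _.
rewrite normrM normCi mul1r !norm_of_real !modulus_of_real -of_realD.
rewrite -[2]/(of_real 1 + of_real 1) -of_realD ler_of_real.
by apply: lerD; rewrite ler_norml; apply/andP; split; lra.
Qed.

Lemma square_sub a s j k : (j <= 2)%N -> (k <= 2)%N ->
  square (node a (s / 3) j k) (s / 3) `<=` square a s.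
Proof.
move=> j2 k2 _ [[x y]/= [/in01P/andP[x0 x1] /in01P/andP[y0 y1]] <-].
have jR : (j%:R : R) <= 2 by rewrite ler_nat.
have kR : (k%:R : R) <= 2 by rewrite ler_nat.
have j0 : 0 <= (j%:R : R) by [].
have k0 : 0 <= (k%:R : R) by [].
exists ((j%:R + x) / 3, (k%:R + y) / 3).
  by split; rewrite /= in_itv /=; apply/andP; split; lra.
by rewrite /node /= !of_realM !of_realD of_realV !of_real_nat; field.
Qed.

(* Goursat's argument: if the bound failed it would fail on one of the nine
   subsquares, and so on; at the limit point of this nested sequence [f] is too
   close to an affine function for the bound to fail. *)
Lemma goursat_square f a0 s0 (e : C) : 0 < s0 -> 0 < e ->
  (forall z, square a0 s0 z -> differentiable f z) ->
  exists n0, forall n, (n0 <= n)%N -> `|square_rsum f n a0 s0| <= e * s0 ^+ 2.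
Proof.
move=> s00 e0 df.
pose P (q : C * C) := exists n0, forall n, (n0 <= n)%N ->
  `|square_rsum f n q.1 q.2| <= e * q.2 ^+ 2.
suff : P (a0, s0) by [].
apply: contrapT => nP.
(* The assumption [~ P q] sits under the existential so that [choice] yields a total function
   [next]. *)
have step (q : C * C) : exists q' : C * C, ~ P q ->
    ~ P q' /\ exists j k, [/\ (j <= 2)%N, (k <= 2)%N &
                q' = (node q.1 (q.2 / 3) j k, q.2 / 3)].
  have [Pq|nPq] := pselect (P q); first by exists q.
  apply: contrapT => nex; apply: nPq.
  have {nex} H j k : (j <= 2)%N -> (k <= 2)%N ->
      P (node q.1 (q.2 / 3) j k, q.2 / 3).
    move=> j2 k2; apply: contrapT => nPjk; apply: nex.
    exists (node q.1 (q.2 / 3) j k, q.2 / 3) => _; split => //.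
    by exists j, k.
  have [n00 P00] := H 0%N 0%N isT isT.
  have [n01 P01] := H 0%N 1%N isT isT.
  have [n02 P02] := H 0%N 2%N isT isT.
  have [n10 P10] := H 1%N 0%N isT isT.
  have [n11 P11] := H 1%N 1%N isT isT.
  have [n12 P12] := H 1%N 2%N isT isT.
  have [n20 P20] := H 2%N 0%N isT isT.
  have [n21 P21] := H 2%N 1%N isT isT.
  have [n22 P22] := H 2%N 2%N isT isT.
  exists (n00 + n01 + n02 + n10 + n11 + n12 + n20 + n21 + n22).+1 => -[//|n] nn.
  rewrite square_rsumS.
  have nn' : (n00 + n01 + n02 + n10 + n11 + n12 + n20 + n21 + n22 <= n)%N by [].
  have [d dE] : exists d, d = e * (q.2 / 3) ^+ 2 by exists (e * (q.2 / 3) ^+ 2).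
  have -> : e * q.2 ^+ 2 = d + (d + d + d + d + d + d + d + d).
    by rewrite dE; field.
  repeat apply: ler_normD_le; rewrite dE.
  - by apply: P11; lia.
  - by apply: P00; lia.
  - by apply: P01; lia.
  - by apply: P02; lia.
  - by apply: P10; lia.
  - by apply: P12; lia.
  - by apply: P20; lia.
  - by apply: P21; lia.
  - by apply: P22; lia.
have [next nextP] := choice step.
pose u n := iter n next (a0, s0).
have uP n : ~ P (u n) by elim: n => [//|n /nextP[]].
have u2 n : (u n).2 = s0 / 3 ^+ n.
  elim: n => [|n IH]; first by rewrite expr0 divr1.
  have [_ [j [k [_ _]]]] := nextP _ (uP n).
  by rewrite /u iterS => ->; rewrite /= -/(u n) IH exprSr invfM mulrA.
have usub n : square (u n.+1).1 (u n.+1).2 `<=` square (u n).1 (u n).2.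
  have [_ [j [k [j2 k2]]]] := nextP _ (uP n).
  by rewrite /u iterS => -> /=; exact: square_sub.
have usub_le n m : (n <= m)%N ->
    square (u m).1 (u m).2 `<=` square (u n).1 (u n).2.
  move=> /subnK <-; elim: (m - n)%N => [//|p IH].
  by apply: subset_trans IH; exact: usub.
have FF : ProperFilter ((fun n => (u n).1) @ \oo).
  exact: fmap_proper_filter.
have uin n : \forall m \near \oo, square (u n).1 (u n).2 (u m).1.
  by exists n => // m /= nm; apply: (usub_le _ _ nm); exact: square_corner.
(* The corners of the nested squares cluster at some [z], which lies in all of these squares because
   they are closed. *)
have [z [_ clz]] := @square_compact R a0 s0 _ FF (uin 0%N).
have zin n : square (u n).1 (u n).2 z.
  have : closed (square (u n).1 (u n).2).
    by apply: compact_closed; [exact: norm_hausdorff|exact: square_compact].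
  by apply=> B; exact: clz (uin n).
have [b db] := cderiv_diff (df z (zin 0%N)).
(* Points of a square are at distance at most twice its side and there are four sides:
   [4 * (e / 8) * 2 = e]. *)
have e8 : 0 < e / 8 by rewrite divr_gt0.
have /nbhs_normP[d /= d0 dP] := db _ e8.
have [n nd] : exists n, 2 * `|(u n).2| < d.
  have [n nd] := exists_invS_lt (divr_gt0 d0 (mulr_gt0 (ltr0n _ 2) s00)).
  exists n.+1; rewrite u2 normrM normfV normrX normr_nat (gtr0_norm s00).
  rewrite mulrA mulrC -ltr_pdivlMr ?mulr_gt0// (le_lt_trans _ nd)//.
  rewrite lef_pV2 ?posrE ?exprn_gt0 ?ltr0n// -natrX ler_nat.
  exact: ltnW (ltn_expl _ _).
apply: (uP n); exists 0%N => m _.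
have sn0 : 0 < (u n).2 by rewrite u2 divr_gt0// exprn_gt0.
(* The affine part has sum exactly 0, so only the remainder of the expansion at [z] has to be
   bounded. *)
have -> : f = (fun w => (f w - f z - b * (w - z)) + ((f z - b * z) + b * w)).
  by apply/funext => w; ring.
rewrite square_rsumD square_rsum_affine addr0.
have -> : e * (u n).2 ^+ 2 = 4 * (e / 8 * (2 * `|(u n).2|)) * `|(u n).2|.
  by rewrite gtr0_norm//; field.
have key w : square (u n).1 (u n).2 w ->
    `|f w - f z - b * (w - z)| <= e / 8 * (2 * `|(u n).2|).
  move=> sw; have wz := square_dist sw (zin n).
  apply: le_trans (dP w _) _; last by rewrite ler_pM2l.
  by rewrite /= distrC (le_lt_trans wz).
apply: square_rsum_bound => t t01.
have [i1 i2 i3 i4] := square_edges (u n).1 (u n).2 t01.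
by split; exact: key.
Qed.

End goursat.

(** * Cauchy's estimate *)

Section cauchy.
Variable R : realType.
Local Notation C := (Cplx R).
Implicit Types (f g : C -> C) (a v s z : C).

Lemma ImD (x y : C) : complex.Im (x + y) = complex.Im x + complex.Im y.
Proof. by case: x; case: y. Qed.

Lemma Im_of_real (x : C) (y : R) : complex.Im (x * of_real y) = complex.Im x * y.
Proof. by case: x => a b /=; rewrite mulr0 add0r. Qed.

(** Lower bounds on imaginary parts, unlike those on norms, pass to sums. The factor [c] is the sign
    with which a side enters the contour. *)
Lemma rsum_Im f n a v (c : C) (K : R) :
  (forall t : C, 0 <= t <= 1 -> K <= complex.Im (c * (f (a + t * v) * v))) ->
  K <= complex.Im (c * rsum f n a v).
Proof.
elim: n a v K => [|n IH] a v K fK /=.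
  have := fK 2^-1; rewrite [2^-1 * v]mulrC; apply.
  by rewrite invr_ge0 ler0n invf_le1// ?ler1n.
have sub (x : C) : 0 <= x -> x <= 2 -> forall t : C, 0 <= t <= 1 ->
    K / 3 <= complex.Im (c * (f (a + x * (v / 3) + t * (v / 3)) * (v / 3))).
  move=> x0 x2 t /andP[t0 t1].
  have -> : a + x * (v / 3) + t * (v / 3) = a + (x + t) / 3 * v by field.
  have t3 : 0 <= (x + t) / 3 <= 1.
    rewrite divr_ge0 ?addr_ge0// ler_pdivrMr// mul1r.
    have -> : 3 = 2 + 1 :> C by ring.
    exact: lerD.
  have := fK _ t3; set y := f _.
  have -> : c * (y * (v / 3)) = c * (y * v) * of_real 3^-1.
    by rewrite of_realV of_real_nat; ring.
  by rewrite Im_of_real ler_pM2r ?invr_gt0.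
have {1}-> : K = K / 3 + K / 3 + K / 3 by field.
rewrite !mulrDr !ImD; apply: lerD; first apply: lerD.
- apply: IH => t t01; have := sub 0 _ _ t t01.
  by rewrite mul0r addr0 => ->.
- apply: IH => t t01; have := sub 1 _ _ t t01.
  by rewrite mul1r => ->//; rewrite ler1n.
- apply: IH => t t01; have := sub 2 _ _ t t01.
  by rewrite mulrDl mul1r addrA => ->.
Qed.

Lemma rsumZ (b : C) f n a v : rsum (fun z => b * f z) n a v = b * rsum f n a v.
Proof. by elim: n a v => [|n IH] a v /=; rewrite ?mulrA// !IH; ring. Qed.

Lemma square_rsumZ (b : C) f n a s :
  square_rsum (fun z => b * f z) n a s = b * square_rsum f n a s.
Proof. by rewrite /square_rsum !rsumZ; ring. Qed.

Definition rect (x y : R) : C := of_real x + 'i * of_real y.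

Lemma Re_rect x y : complex.Re (rect x y) = x.
Proof.
rewrite /rect /of_real; have -> : 'i = 'i%C :> C by rewrite complexiE.
by rewrite /= !(mul0r, mul1r, mulr0, subr0, addr0, add0r).
Qed.

Lemma Im_rect x y : complex.Im (rect x y) = y.
Proof.
rewrite /rect /of_real; have -> : 'i = 'i%C :> C by rewrite complexiE.
by rewrite /= !(mul0r, mul1r, mulr0, subr0, addr0, add0r).
Qed.

Lemma rect_inv x y : x ^+ 2 + y ^+ 2 != 0 ->
  (rect x y)^-1 = rect (x / (x ^+ 2 + y ^+ 2)) (- y / (x ^+ 2 + y ^+ 2)).
Proof.
move=> d0; apply: (@mulfI _ (rect x y)).
  apply: contra_neq d0 => w0.
  have := Re_rect x y; have := Im_rect x y; rewrite w0 /= => <- <-.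
  by rewrite expr0n addr0.
rewrite divff; last first.
  apply: contra_neq d0 => w0.
  have := Re_rect x y; have := Im_rect x y; rewrite w0 /= => <- <-.
  by rewrite expr0n addr0.
set d := _ + _ in d0 *.
have -> : rect x y * rect (x / d) (- y / d) =
    rect ((x ^+ 2 + y ^+ 2) / d) 0.
  have i2 : 'i * 'i = -1 :> C by rewrite -expr2 sqrCi.
  rewrite !expr2 /rect !of_realM !of_realD !of_realM of_realN.
  rewrite (_ : of_real 0 = 0)//.
  ring: i2.
by rewrite -/d divff// /rect (_ : of_real 0 = 0)// mulr0 addr0.
Qed.

(* The lower left corner of the square of side [s] centred at 0. *)
Definition corner s : C := - (s / 2) - 'i * (s / 2).

(** Factoring [s] out reduces the sides to those of the centred unit square, and [dz / z] is
    invariant under this scaling. *)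
Lemma corner_edges s (t : C) : 0 <= t <= 1 -> exists2 x : R, `|x| <= 2^-1 &
  [/\ corner s + t * s = s * rect x (- 2^-1),
      corner s + s + t * ('i * s) = s * rect 2^-1 x,
      corner s + 'i * s + t * s = s * rect x 2^-1 &
      corner s + t * ('i * s) = s * rect (- 2^-1) x].
Proof.
move=> /of_real01[x /in01P/andP[x0 x1] ->]; exists (x - 2^-1).
  by rewrite ler_norml; apply/andP; split; lra.
by rewrite /corner /rect !of_realD !of_realN !of_realV !of_real_nat; split; field.
Qed.

(** A lower bound standing in for the value [2 pi i] of the contour integral of [1 / z]. On each
    side of the unit square the signed integrand has imaginary part [2^-1 / (x ^+ 2 + 2^-1 ^+ 2)],
    which is at least 1 since [|x| <= 2^-1]. *)
Lemma inv_square_rsum s n : 0 < s ->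
  4 <= complex.Im (square_rsum (fun z => z^-1) n (corner s) s).
Proof.
move=> s0; have sN0 : s != 0 by rewrite gt_eqF.
have den (x : R) : `|x| <= 2^-1 -> 0 < x ^+ 2 + 2^-1 ^+ 2 <= 2^-1.
  by rewrite ler_norml => /andP[x1 x2]; apply/andP; split; nra.
have Vs (w : C) : (s * w)^-1 * s = w^-1 by rewrite invfM mulrC mulrA divff// mul1r.
have Vi (w : C) : (s * w)^-1 * ('i * s) = 'i * w^-1.
  by rewrite mulrCA Vs.
have i2 : 'i * 'i = -1 :> C by rewrite -expr2 sqrCi.
have irect x y : 'i * rect x y = rect (- y) x.
  by rewrite /rect of_realN; ring: i2.
have Nrect x y : - rect x y = rect (- x) (- y).
  by rewrite /rect !of_realN; ring.
rewrite /square_rsum.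
have -> : 4 = 1 + 1 + 1 + 1 :> R by ring.
rewrite !ImD; apply: lerD; first apply: lerD; first apply: lerD.
- rewrite -[rsum _ _ _ _]mul1r.
  apply: rsum_Im => t /(corner_edges s)[x x2 [-> _ _ _]].
  have /andP[d0 d1] := den _ x2.
  rewrite mul1r Vs rect_inv sqrrN ?Im_rect ?opprK ?gt_eqF//.
  by rewrite ler_pdivlMr// mul1r.
- rewrite -[rsum _ _ _ _]mul1r.
  apply: rsum_Im => t /(corner_edges s)[x x2 [_ -> _ _]].
  have /andP[d0 d1] := den _ x2.
  rewrite mul1r Vi rect_inv addrC ?irect ?Im_rect ?gt_eqF//.
  by rewrite ler_pdivlMr// mul1r.
- rewrite -mulN1r; apply: rsum_Im => t /(corner_edges s)[x x2 [_ _ -> _]].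
  have /andP[d0 d1] := den _ x2.
  rewrite mulN1r Vs rect_inv ?Nrect ?Im_rect ?gt_eqF//.
  by rewrite mulNr opprK ler_pdivlMr// mul1r.
- rewrite -mulN1r; apply: rsum_Im => t /(corner_edges s)[x x2 [_ _ _ ->]].
  have /andP[d0 d1] := den _ x2.
  rewrite mulN1r Vi rect_inv sqrrN addrC ?irect ?Nrect ?Im_rect ?gt_eqF//.
  by rewrite mulNr opprK ler_pdivlMr// mul1r.
Qed.

Lemma rect_norm_ge x y : (2^-1 <= `|x|) || (2^-1 <= `|y|) -> 2^-1 <= `|rect x y|.
Proof.
have h : 2^-1 = of_real 2^-1 :> C by rewrite of_realV of_real_nat.
rewrite h norm_of_real ler_of_real => /orP[]; move=> /le_trans; apply.
  by rewrite -[x in `|x|](Re_rect x y) norm_Re_le.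
by rewrite -[y in `|y|](Im_rect x y) norm_Im_le.
Qed.

Lemma corner_edges_norm s (t : C) : 0 < s -> 0 <= t <= 1 ->
  [/\ s / 2 <= `|corner s + t * s|,
      s / 2 <= `|corner s + s + t * ('i * s)|,
      s / 2 <= `|corner s + 'i * s + t * s| &
      s / 2 <= `|corner s + t * ('i * s)|].
Proof.
move=> s0 /(corner_edges s)[x x2 [-> -> -> ->]].
have h : 2^-1 <= `|2^-1 : R| by rewrite ger0_norm ?invr_ge0.
by split; rewrite normrM gtr0_norm// ler_pM2l// rect_norm_ge// ?normrN h ?orbT.
Qed.

Lemma corner_node s : node (corner s) (s / 3) 1 1 = corner (s / 3).
Proof. by rewrite /node /corner; field. Qed.

Lemma square_corner0 s : square (corner s) s 0.
Proof.
exists (2^-1, 2^-1); first by split; apply/in01P => /=; apply/andP; split; lra.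
by rewrite /= /corner of_realV of_real_nat; field.
Qed.

Lemma square_node_neq0 s j k : 0 < s -> (j, k) != (1, 1)%N ->
  ~ square (node (corner s) (s / 3) j k) (s / 3) 0.
Proof.
move=> s0 jk [[x y] [/= /in01P/andP[x0 x1] /in01P/andP[y0 y1]]].
have -> : node (corner s) (s / 3) j k +
    (of_real x + 'i * of_real y) * (s / 3) =
    rect (j%:R + x - 3 / 2) (k%:R + y - 3 / 2) * (s / 3).
  rewrite /node /corner /rect.
  rewrite !of_realD !of_realN !of_realM !of_realV !of_real_nat.
  by field.
move=> /eqP; rewrite mulf_eq0 [X in _ || X]gt_eqF ?divr_gt0// orbF => /eqP w0.
have := Re_rect (j%:R + x - 3 / 2) (k%:R + y - 3 / 2).
have := Im_rect (j%:R + x - 3 / 2) (k%:R + y - 3 / 2).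
rewrite w0 /= => ky jx.
(* A cell meets 0 only if its index in each direction lies between 1/2 and 3/2, that is, equals
   1. *)
have nat1 (m : nat) (z : R) :
    0 <= z -> z <= 1 -> 0 = m%:R + z - 3 / 2 -> m = 1%N.
  move=> z0 z1 mz.
  have m1 : (m%:R : R) < 2%:R by lra.
  have m2 : (0%:R : R) < m%:R by lra.
  move: m1 m2; rewrite !ltr_nat; lia.
by move: jk; rewrite (nat1 j x)// (nat1 k y)// eqxx.
Qed.

(** The term [d] belongs to the singularity and passes unchanged from the central square. The term
    in [e] is proportional to area, hence adds up over the nine cells, so the lemma can be
    iterated. *)
Lemma punctured_square_rsum k s (e d : C) : 0 < s -> 0 < e ->
  (forall z, square (corner s) s z -> z != 0 -> differentiable k z) ->
  (exists n0, forall n, (n0 <= n)%N ->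
     `|square_rsum k n (corner (s / 3)) (s / 3)| <= d + e * (s / 3) ^+ 2) ->
  exists n0, forall n, (n0 <= n)%N ->
     `|square_rsum k n (corner s) s| <= d + e * s ^+ 2.
Proof.
move=> s0 e0 dk [n11 P11].
have H i j : (i <= 2)%N -> (j <= 2)%N -> (i, j) != (1, 1)%N ->
    exists n0, forall n, (n0 <= n)%N ->
    `|square_rsum k n (node (corner s) (s / 3) i j) (s / 3)| <= e * (s / 3) ^+ 2.
  move=> i2 j2 ij; apply: goursat_square => //; first by rewrite divr_gt0.
  move=> z sz; apply: dk; first exact: square_sub sz.
  by apply/eqP => z0; move: sz; rewrite z0; exact: square_node_neq0.
have [n00 P00] := H 0%N 0%N isT isT isT; have [n01 P01] := H 0%N 1%N isT isT isT.
have [n02 P02] := H 0%N 2%N isT isT isT; have [n10 P10] := H 1%N 0%N isT isT isT.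
have [n12 P12] := H 1%N 2%N isT isT isT; have [n20 P20] := H 2%N 0%N isT isT isT.
have [n21 P21] := H 2%N 1%N isT isT isT; have [n22 P22] := H 2%N 2%N isT isT isT.
exists (n00 + n01 + n02 + n10 + n11 + n12 + n20 + n21 + n22).+1 => -[//|n] nn.
have {}nn : (n00 + n01 + n02 + n10 + n11 + n12 + n20 + n21 + n22 <= n)%N by [].
rewrite square_rsumS corner_node.
have [c cE] : exists c, c = e * (s / 3) ^+ 2 by exists (e * (s / 3) ^+ 2).
have -> : d + e * s ^+ 2 = (d + c) + (c + c + c + c + c + c + c + c).
  by rewrite cE; field.
apply: ler_normD_le; first by rewrite cE; apply: P11; lia.
repeat apply: ler_normD_le; rewrite cE.
- by apply: P00; lia.
- by apply: P01; lia.
- by apply: P02; lia.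
- by apply: P10; lia.
- by apply: P12; lia.
- by apply: P20; lia.
- by apply: P21; lia.
- by apply: P22; lia.
Qed.

(* The integrand is o(1/z) at 0, so on a small square centred at 0 its sums are
   small; the squares filling the rest do not contain 0, and Goursat applies. *)
Lemma singular_square_rsum f s (b d e : C) : 0 < s -> 0 < d -> 0 < e ->
  (forall z, square (corner s) s z -> differentiable f z) -> cderiv f 0 b ->
  exists n0, forall n, (n0 <= n)%N ->
    `|square_rsum (fun z => (f z - f 0 - b * z) * (z * z)^-1) n (corner s) s|
      <= d + e * s ^+ 2.
Proof.
move=> s0 d0 e0 df fb.
set k := (fun z => _).
have dk z : square (corner s) s z -> z != 0 -> differentiable k z.
  move=> /df dfz z0.
  have did : differentiable (fun z : C => z) z by case: (is_diff_id z).
  have dz : differentiable (fun z : C => z * z) z by exact: differentiableM.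
  apply: differentiableM.
    apply: differentiableB.
      by apply: differentiableB => //; exact: differentiable_cst.
    by apply: differentiableM; [exact: differentiable_cst|].
  by apply: differentiableV => //; rewrite mulf_neq0.
have d8 : 0 < d / 8 by rewrite divr_gt0.
have /nbhs_normP[c /= c0 cP] := fb _ d8.
have [m md] : exists m, 2 * (s / 3 ^+ m) < c.
  have [n nd] := exists_invS_lt (divr_gt0 c0 (mulr_gt0 (ltr0n _ 2) s0)).
  exists n.+1; rewrite mulrA mulrC -ltr_pdivlMr ?mulr_gt0// (le_lt_trans _ nd)//.
  rewrite lef_pV2 ?posrE ?exprn_gt0 ?ltr0n// -natrX ler_nat.
  exact: ltnW (ltn_expl _ _).
elim: m s s0 dk md {df} => [|m IH] s s0 dk md.
  move: md; rewrite expr0 divr1 => sc.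
  exists 0%N => n _.
  (* On the boundary [|z| >= s / 2], so the integrand, at most [d / 8 / |z|], is at most
     [d / 8 * (2 / s)]; four sides of length [s] give [d]. *)
  have -> : d + e * s ^+ 2 = 4 * (d / 8 * (2 / s)) * s + e * s ^+ 2.
    by field; rewrite gt_eqF.
  apply: le_trans (_ : _ <= 4 * (d / 8 * (2 / s)) * s) _; last first.
    by rewrite lerDl mulr_ge0 ?exprn_ge0// ltW.
  rewrite -[X in _ * X](gtr0_norm s0).
  have key z : square (corner s) s z -> s / 2 <= `|z| ->
      `|k z| <= d / 8 * (2 / s).
    move=> sz zs; have z0 : 0 < `|z| by apply: lt_le_trans zs; rewrite divr_gt0.
    rewrite /k normrM normfV normrM invfM mulrA.
    apply: ler_pM; rewrite ?mulr_ge0 ?invr_ge0//; last first.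
      by rewrite -[2 / s]invrK lef_pV2 ?posrE ?invr_gt0 ?divr_gt0// invf_div.
    rewrite ler_pdivrMr//.
    have := cP z; rewrite /= sub0r normrN subr0; apply.
    have := square_dist sz (square_corner0 s); rewrite subr0 (gtr0_norm s0).
    by move=> /le_lt_trans; apply.
  apply: square_rsum_bound => t t01.
  have [i1 i2 i3 i4] := square_edges (corner s) s t01.
  have [j1 j2 j3 j4] := corner_edges_norm s0 t01.
  by split; apply: key.
apply: punctured_square_rsum => //; apply: IH; first by rewrite divr_gt0.
  move=> z sz; apply: dk; move: sz; rewrite -corner_node.
  exact: square_sub.
by move: md; rewrite exprS invfM !mulrA.
Qed.

Lemma Im_le_norm (z : C) (x : R) : x <= complex.Im z -> of_real x <= `|z|.
Proof.
move=> xz; rewrite norm_of_real ler_of_real (le_trans xz)//.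
by rewrite (le_trans (ler_norm _))// norm_Im_le.
Qed.

(** Write [(f z - f 0) / z ^+ 2] as the singular remainder [k] plus [b / z]. The sum of the left
    side is at most [32 * M / s], that of [k] is arbitrarily small, and that of [b / z] has norm at
    least [4 * |b|]. *)
Lemma cauchy_estimate f s (b M : C) : 0 < s ->
  (forall z, square (corner s) s z -> differentiable f z) ->
  (forall z, square (corner s) s z -> `|f z| <= M) -> cderiv f 0 b ->
  `|b| * s <= 8 * M.
Proof.
move=> s0 df fM fb.
have M0 : 0 <= M := le_trans (normr_ge0 _) (fM 0 (square_corner0 s)).
rewrite real_leNgt ?ger0_real ?mulr_ge0// ?ltW//; apply/negP => Mb.
(* A quarter of the supposed gap. The sum of [k] will be bounded by [e + e], one from each error
   term, which leaves half the gap for the contradiction. *)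
pose e := (4 * `|b| - 32 * M / s) / 4.
have e0 : 0 < e.
  rewrite divr_gt0// subr_gt0 ltr_pdivrMr//.
  have -> : 32 * M = 4 * (8 * M) by ring.
  by rewrite -mulrA ltr_pM2l.
have es0 : 0 < e / s ^+ 2 by rewrite divr_gt0 ?exprn_gt0.
have [n0 /(_ n0 (leqnn _)) H] := singular_square_rsum s0 e0 es0 df fb.
set k := (fun z => _) in H.
pose g z := (f z - f 0) * (z * z)^-1.
have gE : g = (fun z => k z + b * z^-1).
  (* At 0 both sides vanish because the inverse of 0 is 0. *)
  apply/funext => z; rewrite /g /k; have [->|z0] := eqVneq z 0.
    by rewrite !(mulr0, invr0, addr0).
  by field.
have gM : `|square_rsum g n0 (corner s) s| <= 32 * M / s.
  have -> : 32 * M / s = 4 * (2 * M * (2 / s) ^+ 2) * `|s|.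
    by rewrite gtr0_norm//; field; rewrite gt_eqF.
  have key z : square (corner s) s z -> s / 2 <= `|z| ->
      `|g z| <= 2 * M * (2 / s) ^+ 2.
    move=> sz zs; have z0 : 0 < `|z| by apply: lt_le_trans zs; rewrite divr_gt0.
    rewrite /g normrM normfV normrM -expr2 -exprVn.
    apply: ler_pM; rewrite ?exprn_ge0 ?invr_ge0//.
      rewrite mulrDl mul1r; apply: le_trans (ler_normB _ _) _.
      by apply: lerD; [exact: fM|apply: fM; exact: square_corner0].
    rewrite lerXn2r ?nnegrE ?invr_ge0 ?divr_ge0 ?(ltW s0)//.
    by rewrite -[2 / s]invrK lef_pV2 ?posrE ?invr_gt0 ?divr_gt0// invf_div.
  apply: square_rsum_bound => t t01.
  have [i1 i2 i3 i4] := square_edges (corner s) s t01.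
  have [j1 j2 j3 j4] := corner_edges_norm s0 t01.
  by split; apply: key.
move: gM; rewrite gE square_rsumD square_rsumZ.
have := Im_le_norm (inv_square_rsum n0 s0); rewrite of_real_nat.
set I := square_rsum _ _ _ _; set J := square_rsum _ _ _ _ in H * => I4 JM.
have : 4 * `|b| <= 32 * M / s + (e + e).
  apply: le_trans (_ : _ <= `|b * I|) _; first by rewrite normrM mulrC ler_wpM2l.
  have -> : b * I = (J + b * I) - J by ring.
  apply: le_trans (ler_normB _ _) _; apply: lerD => //.
  by apply: le_trans H _; rewrite divfK ?expf_neq0 ?gt_eqF.
have lt : 32 * M / s + (e + e) < 4 * `|b|.
  have -> : 4 * `|b| = 32 * M / s + (e + e) + (e + e).
    by rewrite /e; field; rewrite gt_eqF.
  by rewrite ltrDl addr_gt0.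
by move=> /(lt_le_trans lt); rewrite ltxx.
Qed.

End cauchy.

(** * Local openness *)

Section local_openness.
Variable R : realType.
Local Notation C := (Cplx R).

Lemma linear_inj_surj (F : fieldType) N (L : {linear 'rV[F]_N -> 'rV[F]_N}) :
  injective L -> forall u, exists w, L w = u.
Proof.
move=> Linj u; set M := lin1_mx L.
have : row_free M.
  rewrite -kermx_eq0; apply/eqP/row_matrixP => i; rewrite row0.
  apply: Linj; rewrite linear0 -mul_rV_lin1 -/M -row_mul mulmx_ker row0 //.
rewrite row_free_unit => Mu; exists (u *m invmx M).
by rewrite -mul_rV_lin1 -/M mulmxKV.
Qed.

Lemma modulus_norm_continuous N (y : 'rV[C]_N) (T : topologicalType)
    (G : T -> 'rV[C]_N) (x : T) :
  {for x, continuous G} -> {for x, continuous (fun x => modulus `|G x - y|)}.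
Proof.
move=> cG; have FF : Filter (nbhs x) by exact: nbhs_filter.
apply/(@cvgrPdist_lt _ _ _ _ FF) => e e0.
have e0' : 0 < of_real e by rewrite (ltr_of_real 0).
have := @cvgr_dist_lt _ _ _ _ FF _ _ cG _ e0'.
apply: filterS => z xz.
rewrite -ltr_of_real -[X in of_real X]modulus_of_real -norm_of_real of_realD of_realN.
rewrite !of_real_ge0//; apply: le_lt_trans (ler_dist_dist _ _) _.
by rewrite opprB addrA subrK.
Qed.

(* A minimiser of [`|G x - y|] over the ball is interior when [y] is close to
   [G p], and moving it by a small multiple of the solution of
   ['d G x w = y - G x] would decrease the distance unless [G x = y]. *)
Lemma local_open_image N (G : 'rV[C]_N -> 'rV[C]_N) (p : 'rV[C]_N) (r : C) :
  0 < r ->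
  (forall x, `|x - p| <= r -> differentiable G x /\ injective ('d G x)) ->
  (forall x, `|x - p| <= r -> G x = G p -> x = p) ->
  nbhs (G p) (G @` [set x | `|x - p| <= r]).
Proof.
move=> r0 dG Ginj.
set B := [set x | _].
have cB : compact B by apply: rV_closed_ball_compact; exact: ltW.
have cG x : B x -> {for x, continuous G}.
  by move=> /dG[/differentiable_continuous].
pose nm (x : 'rV[C]_N) := modulus `|x - p|.
have nmc : continuous nm.
  by move=> x; apply: (@modulus_norm_continuous _ p _ id); exact: cvg_id.
(* [S] is the boundary sphere. Its image is compact and misses [G p], hence stays at some distance
   [d] from it. *)
pose S := B `&` nm @^-1` [set t | modulus r <= t].
have cS : compact S.
  apply: compact_closedI => //; apply: preimage_closed; last exact: closed_ge.
  by move=> x _; exact: nmc.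
have nmE x : `|x - p| = of_real (nm x) by rewrite /nm of_real_ge0.
have rE : r = of_real (modulus r) by rewrite of_real_ge0// ltW.
have SB : S `<=` B by move=> x [].
have cGS : compact (G @` S).
  apply: continuous_compact => //; apply: continuous_in_subspaceT => x.
  by rewrite inE => /SB /cG.
have GpS : ~ (G @` S) (G p).
  move=> [x [Bx /= rx] /(Ginj _ Bx) xp]; move: rx; rewrite xp /nm subrr normr0.
  have -> : modulus (0 : C) = 0.
    by rewrite -[0 : C]/(of_real 0) modulus_of_real normr0.
  by rewrite leNgt -ltr_of_real -rE r0.
have clGS : closed (G @` S).
  by apply: compact_closed => //; exact: norm_hausdorff.
have /nbhs_normP[d /= d0 dS] : nbhs (G p) (~` (G @` S)).
  by apply: open_nbhs_nbhs; split => //; exact: closed_openC.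
have d20 : 0 < d / 2 by rewrite divr_gt0.
have := near_dist_lt (G p) d20; apply: filterS => y yd.
have B0 : B !=set0 by exists p; rewrite /B /= subrr normr0 ltW.
have cm : {within B, continuous (fun x => modulus `|G x - y|)}.
  apply: continuous_in_subspaceT => x; rewrite inE => Bx.
  by apply: modulus_norm_continuous; exact: cG.
have [x] := compact_EVT_min B0 cB cm.
rewrite inE => Bx xmin.
have {}xmin z : B z -> `|G x - y| <= `|G z - y|.
  move=> Bz; rewrite -[`|G x - y|]of_real_ge0// -[`|G z - y|]of_real_ge0//.
  by rewrite ler_of_real xmin// inE.
exists x => //.
have Bp : B p by rewrite /B /= subrr normr0 ltW.
have xr : `|x - p| < r.
  have nS : ~ S x.
    move=> Sx; apply: (dS (G x)); last by exists x.
    rewrite /= -(subrK y (G p)) -addrA; apply: le_lt_trans (ler_normD _ _) _.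
    rewrite [d]splitr ltr_leD//; last first.
      by rewrite distrC (le_trans (xmin _ Bp))// ltW.
  rewrite nmE rE ltr_of_real ltNge; apply/negP => xr.
  by apply: nS; split.
apply: contrapT => /eqP Gxy.
have m0 : 0 < `|G x - y| by rewrite normr_gt0 subr_eq0.
have [dGx iGx] := dG _ Bx.
have [w wE] := linear_inj_surj iGx (y - G x).
set m := `|G x - y| in m0 xmin.
have w1 : 0 < `|w| + 1 by rewrite ltr_wpDl.
(* Moving by [t *: w] gains [m * t] to first order, and with this [e] the error is at most half of
   that. *)
pose e := m / (2 * (`|w| + 1)).
have e0 : 0 < e by rewrite divr_gt0// mulr_gt0.
have /diff_locallyP[_ /eqaddoP /(_ e e0)] := dGx.
move=> /nbhs_normP[c /= c0 cP].
have rx0 : 0 < r - `|x - p| by rewrite subr_gt0.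
(* [n1] makes the step small enough for the expansion at [x], [n2] for staying in the ball. *)
have [n1 n1P] := exists_invS_lt (divr_gt0 c0 w1).
have [n2 n2P] := exists_invS_lt (divr_gt0 rx0 w1).
pose n := (n1 + n2)%N; pose t : C := n.+1%:R^-1.
have t0 : 0 < t by rewrite invr_gt0 ltr0n.
have t1 : t <= 1 by rewrite invf_le1 ?ltr0n// ler1n.
have tn k : (k <= n)%N -> t <= k.+1%:R^-1.
  by move=> kn; rewrite lef_pV2 ?posrE ?ltr0n// ler_nat.
have tw k (b : C) : (k <= n)%N -> k.+1%:R^-1 < b / (`|w| + 1) -> `|t *: w| < b.
  move=> /tn tk kb; rewrite normrZ (gtr0_norm t0).
  apply: (@le_lt_trans _ _ (t * (`|w| + 1))); first by rewrite ler_pM2l// lerDl.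
  by rewrite -ltr_pdivlMr// (le_lt_trans tk).
have twc : `|t *: w| < c by apply: (tw n1) => //; exact: leq_addr.
have twr : `|t *: w| < r - `|x - p| by apply: (tw n2) => //; exact: leq_addl.
have Bz : B (t *: w + x).
  rewrite /B /= -addrA; apply: le_trans (ler_normD _ _) _.
  by rewrite -lerBrDr ltW.
have := cP (t *: w); rewrite /= sub0r normrN => /(_ twc).
rewrite !fctE /= linearZ/= wE => H.
have : m < m; last by rewrite ltxx.
apply: le_lt_trans (xmin _ Bz) _.
have -> : G (t *: w + x) - y =
    (G (t *: w + x) - (G x + t *: (y - G x))) + (1 - t) *: (G x - y).
  rewrite scalerBl scale1r !scalerBr !opprD !opprK.
  move: (G _) (t *: y) (t *: G x) => a1 a2 a3.
  by apply/rowP => i; rewrite !mxE; ring.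
apply: le_lt_trans (ler_normD _ _) _.
rewrite normrZ (ger0_norm (_ : 0 <= 1 - t)) ?subr_ge0// -/m.
apply: (@le_lt_trans _ _ (m / 2 * t + (1 - t) * m)).
  rewrite lerD2r; apply: le_trans H _.
  rewrite normrZ (gtr0_norm t0).
  have -> : e * (t * `|w|) = m / 2 * t * (`|w| / (`|w| + 1)).
    by rewrite /e; field; rewrite gt_eqF.
  apply: ler_piMr; last by rewrite ler_pdivrMr// mul1r lerDl.
  by rewrite mulr_ge0 ?divr_ge0 ?ltW.
rewrite [ltRHS](_ : m = m * t + (1 - t) * m); last by ring.
rewrite ltrD2r ltr_pM2r// ltr_pdivrMr// ltr_pMr//.
by rewrite ltr1n.
Qed.

End local_openness.

(** * Iterates of a continuous map *)

Section dynamics.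
Variable T : topologicalType.
Implicit Types (phi : T -> T).

Lemma iter_continuous phi n : continuous phi -> continuous (iter n phi).
Proof.
move=> cphi; elim: n => [|n IH] x; first exact: cvg_id.
apply: (@continuous_comp _ _ _ (iter n phi) phi); first exact: IH.
exact: cphi.
Qed.

Lemma increasing_geq k : increasing k -> forall n, (n <= k n)%N.
Proof.
move=> ik; elim=> [//|n IH].
by apply: leq_ltn_trans IH _; exact: ik.
Qed.

(** The prolongational limit set of topological dynamics: unlike in [omega_limit], the starting
    point may vary near [x]. *)
Definition prolongation_limit phi (x w : T) := forall (U W : set T) m,
  nbhs x U -> nbhs w W ->
  exists q y, [/\ (m <= q)%N, U y & W (iter q phi y)].

Definition omega_limit phi (x w : T) := forall (W : set T) m, nbhs w W ->
  exists q, (m <= q)%N /\ W (iter q phi x).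

Lemma iterB phi m n x : (m <= n)%N ->
  iter (n - m) phi (iter m phi x) = iter n phi x.
Proof. by move=> mn; rewrite -iterD subnK. Qed.

(** Take a cluster point in [K * K] of the pairs formed by a point of [K] and its image in [K]. *)
Lemma compact_prolongation phi k (K : set T) : increasing k -> compact K ->
  (forall l, (iter (k l) phi @` K) `&` K !=set0) ->
  exists x w, prolongation_limit phi x w.
Proof.
move=> ik cK H.
have /choice[u uP] : forall l, exists x, K x /\ K (iter (k l) phi x).
  by move=> l; have [_ [[x Kx <-] Kw]] := H l; exists x.
have FF : ProperFilter ((fun l => (u l, iter (k l) phi (u l))) @ \oo).
  exact: fmap_proper_filter.
have [|[x w] [_ cl]] := @compact_setX _ _ K K cK cK _ FF.
  by exists 0%N => // l _; split; apply uP.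
exists x, w => U W m Ux Ww.
pose E := [set p : T * T | exists2 q, (m <= q)%N & p.2 = iter q phi p.1].
have Em : ((fun l => (u l, iter (k l) phi (u l))) @ \oo) E.
  exists m => // l /= ml; exists (k l) => //.
  exact: leq_trans ml (increasing_geq ik _).
have Ed : nbhs (x, w) (U `*` W) by exists (U, W).
have [[y z] [[q mq /= zE] [/= Uy Wz]]] := cl E _ Em Ed.
by exists q, y; split => //; rewrite -zE.
Qed.

Lemma recurrent_compact_orbit phi w (V : set T) : continuous phi ->
  (forall x y, prolongation_limit phi x y -> omega_limit phi x y) ->
  omega_limit phi w w -> compact V -> nbhs w V ->
  exists2 K, compact K & forall n, K (iter n phi w).
Proof.
move=> cphi JO ww cV Vw.
set O := range (fun n => iter n phi w).
(* The orbit of [w] comes close to [x] and later returns to [w], so [w] is a prolongational limit of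
   [x], hence an omega-limit by [JO]. *)
have minimal x : closure O x -> omega_limit phi x w.
  move=> Ox; apply: JO => U W m Ux Ww.
  have [_ [[n1 _ <-] Un1]] := Ox _ Ux.
  have [n2 [n12 Wn2]] := ww W (m + n1)%N Ww.
  exists (n2 - n1)%N, (iter n1 phi w); rewrite iterB; last by lia.
  by split => //; lia.
have cC : compact (V `&` closure O).
  by apply: compact_closedI => //; exact: closed_closure.
pose P N x := exists r, [/\ (0 < r)%N, (r <= N)%N & V (iter r phi x)].
(* A return time to the interior of [V] works on a whole neighbourhood, so compactness bounds the
   return times uniformly. *)
have [N NP] : exists N, forall x, V x -> closure O x -> P N x.
  have [|N _ NP] := (compact_near_coveringP _).1 cC nat \oo P _.
    move=> x [Vx Ox]; have [q [q1 Vq]] := minimal x Ox _ 1%N (nbhs_interior Vw).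
    exists (iter q phi @^-1` V^°, [set n | (q <= n)%N]).
      split; last by exists q.
      apply: (@iter_continuous phi q cphi x); apply: open_nbhs_nbhs.
      by split => //; exact: open_interior.
    move=> [y n] [/= Vy qn]; exists q; split => //.
    exact: interior_subset Vy.
  by exists N => x Vx Ox; apply: (NP N (leqnn _)).
exists (\bigcup_(i in `I_N.+1) (iter i phi @` V)).
  rewrite bigcup_mkord; apply: bigsetU_compact => i _.
  apply: continuous_compact => //; apply: continuous_subspaceT.
  exact: iter_continuous.
(* At every time [n] the orbit visited [V] at some time [s] at most [N] steps earlier. *)
suff orbit n : exists i s, [/\ (i <= N)%N, n = (i + s)%N & V (iter s phi w)].
  move=> n; have [i [s [iN -> Vs]]] := orbit n.
  by exists i => //; exists (iter s phi w) => //; rewrite iterD.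
elim: n => [|n [i [s [iN ns Vs]]]].
  by exists 0%N, 0%N; split => //; exact: nbhs_singleton Vw.
have [iN'|] := ltnP i N.
  by exists i.+1, s; split => //; rewrite ns.
move=> Ni.
have [|r [r0 rN Vr]] := NP _ Vs.
  by apply: subset_closure; exists s.
(* When [i = N], the visit is replaced by the next one, [r] steps later; [r > 0] keeps the new delay
   at most [N]. *)
exists (N.+1 - r)%N, (r + s)%N; split; [lia|lia|].
by rewrite iterD.
Qed.

Lemma prolongation_recurrent phi x w :
  omega_limit phi x w -> prolongation_limit phi w w.
Proof.
move=> xw U W m Uw Ww.
have [n1 [_ Un1]] := xw U 0%N Uw.
have [n2 [n12 Wn2]] := xw W (m + n1)%N Ww.
exists (n2 - n1)%N, (iter n1 phi x); rewrite iterB; last by lia.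
by split => //; lia.
Qed.

Lemma run_away_subsequence phi k : continuous phi ->
  (forall x : T, exists2 V : set T, compact V & nbhs x V) ->
  (forall x y, prolongation_limit phi x y -> omega_limit phi x y) ->
  run_away (fun n => iter n phi) -> increasing k ->
  run_away (fun l => iter (k l) phi).
Proof.
move=> cphi lc JO ra ik K cK; apply: contrapT => nra.
have [|x [w xw]] := compact_prolongation ik cK (phi := phi).
  by move=> l; apply/set0P/eqP => e; apply: nra; exists l.
have {}xw := JO _ _ xw.
have ww := JO _ _ (prolongation_recurrent xw).
have [V cV Vw] := lc w.
have [K' cK' K'w] := recurrent_compact_orbit cphi JO ww cV Vw.
have [l] := ra _ cK'; apply/eqP/set0P.
by exists (iter l phi w); split => //; exists w => //; exact: (K'w 0%N).
Qed.

(** The inverse of [phi] on its range is continuous by openness: a cluster point of the pushed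
    filter pulls back to one of the given filter. *)
Lemma compact_preimage_open_inj phi (K : set T) : injective phi ->
  (forall (x : T) (B : set T), nbhs x B -> nbhs (phi x) (phi @` B)) ->
  compact K -> K `<=` range phi -> compact (phi @^-1` K).
Proof.
move=> iphi ophi cK Kr F FF FK.
have PF : ProperFilter (phi @ F) by exact: fmap_proper_filter.
have [y [Ky cl]] := cK _ PF FK.
have [x _ xy] := Kr _ Ky; exists x; split; first by rewrite /= xy.
move=> A B FA Bx.
have FA' : (phi @ F) (phi @` A) by apply: (@filterS _ F _ A) FA => a Aa; exists a.
have := ophi _ _ Bx; rewrite xy => By.
have [_ [[a Aa <-] [b Bb /iphi ba]]] := cl _ _ FA' By.
by exists a; split => //; rewrite -ba.
Qed.

End dynamics.

(** * Holomorphic maps in charts *)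

Lemma diff_near_eq (K : numFieldType) (V W : normedModType K)
    (f g : V -> W) (x : V) :
  (\near x, f x = g x) -> differentiable f x -> 'd g x = 'd f x :> (V -> W).
Proof.
move=> fg df.
have dfc : continuous ('d f x) by case/diff_locallyP : df.
have fgx : f x = g x by exact: nbhs_singleton fg.
apply: (diff_unique dfc).
apply/eqaddoP => _/posnumP[e].
have /diff_locallyP[_ /eqaddoP /(_ e%:num (ltac:(done))) H] := df.
have fg' : \forall h \near (0 : V), f (h + x) = g (h + x).
  move: fg; rewrite (near_shift 0 x) => fg.
  by apply: filterS fg => h /=; rewrite subr0.
by apply: filterS2 H fg' => h + fgh; rewrite /= !fctE /= -fgh -fgx.
Qed.

Section manifold.
Variables (R : realType) (N : nat) (M : complexManifold R N).
Local Notation C := (Cplx R).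
Implicit Types (c : chart R N M) (z : M).

Lemma chart_mapK c z : atlas c -> chart_dom c z -> chart_inv c (chart_map c z) = z.
Proof. by move=> /atlas_chart[_ _ _ _ cK] /cK. Qed.

Lemma chart_map_continuous c z : atlas c -> chart_dom c z ->
  {for z, continuous (chart_map c)}.
Proof.
move=> /atlas_chart[od _ cm _ _] zc.
by move: cm; rewrite continuous_open_subspace// => /(_ _ (mem_set zc)).
Qed.

Lemma chart_inv_continuous c z : atlas c -> chart_dom c z ->
  {for chart_map c z, continuous (chart_inv c)}.
Proof.
move=> /atlas_chart[_ oi _ ci _] zc.
have zimg : (chart_map c @` chart_dom c) (chart_map c z) by exists z.
by move: ci; rewrite continuous_open_subspace// => /(_ _ (mem_set zimg)).
Qed.

Lemma nbhs_chart_inv c z (A : set M) : atlas c -> chart_dom c z -> nbhs z A ->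
  \forall y \near chart_map c z, A (chart_inv c y).
Proof.
move=> ac zc zA; have H := chart_inv_continuous ac zc.
by apply: H; rewrite chart_mapK.
Qed.

Lemma nbhs_chart_dom c z : atlas c -> chart_dom c z -> nbhs z (chart_dom c).
Proof. by move=> /atlas_chart[od _ _ _ _] zc; exact: open_nbhs_nbhs. Qed.

Lemma nbhs_chart_image c z : atlas c -> chart_dom c z ->
  nbhs (chart_map c z) (chart_map c @` chart_dom c).
Proof.
by move=> /atlas_chart[_ oi _ _ _] zc; apply: open_nbhs_nbhs; split => //; exists z.
Qed.

(** Passing through the coordinates of [c] makes the chain rule of normed spaces available when the
    middle space is [M]. Equality is only local since [chart_inv] inverts on the chart domain
    alone. *)
Lemma through_chart (W V : normedModType C) c (g : M -> V) (h : W -> M) (p : W) :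
  atlas c -> chart_dom c (h p) -> {for p, continuous h} ->
  \forall q \near p, ((g \o chart_inv c) \o (chart_map c \o h)) q = (g \o h) q.
Proof.
move=> ac hp ch.
have H : \forall q \near p, chart_dom c (h q) by exact: ch (nbhs_chart_dom ac hp).
by apply: filterS H => q /= /(chart_mapK ac) ->.
Qed.

Lemma differentiable_through_chart (W V : normedModType C) c (g : M -> V)
    (h : W -> M) (p : W) :
  atlas c -> chart_dom c (h p) -> {for p, continuous h} ->
  differentiable (g \o chart_inv c) (chart_map c (h p)) ->
  differentiable (chart_map c \o h) p -> differentiable (g \o h) p.
Proof.
move=> ac hp ch dg dh.
apply: (differentiable_near_eq (through_chart g ac hp ch)).
exact: differentiable_comp.
Qed.

Lemma diff_through_chart (W V : normedModType C) c (g : M -> V)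
    (h : W -> M) (p : W) :
  atlas c -> chart_dom c (h p) -> {for p, continuous h} ->
  differentiable (g \o chart_inv c) (chart_map c (h p)) ->
  differentiable (chart_map c \o h) p ->
  'd (g \o h) p =
    'd (g \o chart_inv c) (chart_map c (h p)) \o 'd (chart_map c \o h) p
    :> (W -> V).
Proof.
move=> ac hp ch dg dh.
rewrite (diff_near_eq (through_chart g ac hp ch)).
  exact: diff_comp.
exact: differentiable_comp.
Qed.

Lemma stein_locally_compact : stein M ->
  forall z : M, exists2 V : set M, compact V & nbhs z V.
Proof.
move=> [[K [cK Kint Kcov]] _ _ _] z.
have [l _ Klz] : (\bigcup_l K l) z by rewrite Kcov.
by exists (K l.+1) => //; exact: Kint.
Qed.

Lemma holomorphic_map_id : holomorphic_map (@id M).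
Proof.
split; first by move=> z; exact: cvg_id.
by move=> c c' ac ac' z zc zc'; exact: (atlas_compatible ac ac').
Qed.

Lemma comp_chart_inv_continuous (T : topologicalType) (f : M -> T) c z :
  continuous f -> atlas c -> chart_dom c z ->
  {for chart_map c z, continuous (f \o chart_inv c)}.
Proof.
move=> cf ac zc; apply: continuous_comp; first exact: chart_inv_continuous.
exact: cf.
Qed.

Lemma holomorphic_map_iter (phi : M -> M) n :
  holomorphic_map phi -> holomorphic_map (iter n phi).
Proof.
move=> [cphi dphi]; elim: n => [|n [cn dn]]; first exact: holomorphic_map_id.
split; first exact: (iter_continuous (n := n.+1) cphi).
move=> c c'' ac ac'' z zc zc''.
have [c' ac' c'z] := atlas_cover (iter n phi z).
apply: (@differentiable_through_chart _ _ c' (chart_map c'' \o phi)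
  (iter n phi \o chart_inv c)) => //=.
- by rewrite chart_mapK.
- exact: comp_chart_inv_continuous.
- by rewrite chart_mapK//; apply: dphi.
- exact: dn.
Qed.

End manifold.

(** * Hypercyclicity as approximation on compact sets *)

Section hypercyclic.
Variables (R : realType) (N : nat) (M : complexManifold R N).
Local Notation C := (Cplx R).
Variables (phi : M -> M) (hphi : holomorphic_map phi).

Lemma iter_comp_opE n (F : hol_space M) z :
  set_val (iter n (comp_op hphi) F) z = set_val F (iter n phi z).
Proof. by elim: n z => [//|n IH] z; rewrite [in RHS]iterSr -IH. Qed.

Lemma hol_space_nbhs (g : hol_space M) (K : set M) (e : R) :
  compact K -> 0 < e ->
  nbhs g [set h : hol_space M |
    forall z, K z -> modulus (set_val h z - set_val g z) < e].
Proof.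
move=> cK e0.
have FN : Filter (nbhs g) by exact: nbhs_filter.
have H : {family compact, (set_val @ g) --> (set_val g)}.
  exact: (@initial_continuous _ _ (@set_val _ (hol_space M))).
have {}H := (@fam_cvgP _ _ _ _ _ (@fmap_filter _ _ _ _ FN)).1 H _ cK.
pose E := [set xy : C * C | modulus (xy.2 - xy.1) < e].
have : nbhs (set_val g : {uniform` K -> C})
    [set h | forall y, K y -> E (set_val g y, h y)].
  apply/uniform_nbhs; exists E; split => //.
  rewrite -entourage_ballE; exists (of_real e); first by rewrite /= (ltr_of_real 0).
  by move=> [x y] /=; rewrite -ball_normE /= distrC norm_of_real ltr_of_real.
by move=> /H; apply: (@filterS _ _ FN).
Qed.

Lemma hypercyclic_approx : hypercyclic (comp_op hphi) ->
  exists2 f : M -> C, holomorphic f & forall (g : M -> C) (K : set M) (e : R),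
    holomorphic g -> compact K -> 0 < e ->
    exists n, forall z, K z -> modulus (f (iter n phi z) - g z) < e.
Proof.
move=> [F dF]; exists (set_val F); first exact: (set_mem (valP F)).
move=> g K e hg cK e0.
pose G : hol_space M := exist _ (g : {family compact, M -> C}) (mem_set hg).
have H := hol_space_nbhs G cK e0; set A := [set h | _] in H.
have A0 : A^° !=set0 by exists G.
have [h [hO [n _ nh]]] := dF _ A0 (open_interior _).
exists n => z Kz; have := interior_subset hO z Kz.
by rewrite -nh iter_comp_opE.
Qed.

End hypercyclic.

(** * Composition operators with dense range *)

Section modulus_lemmas.
Variable R : realType.
Local Notation C := (Cplx R).
Implicit Types x y z : C.

Lemma modulusD x y : modulus (x + y) <= modulus x + modulus y.
Proof. by rewrite -ler_of_real of_realD -!norm_of_real ler_normD. Qed.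

Lemma modulus_dist x y : modulus (x - y) = modulus (y - x).
Proof.
by have : of_real (modulus (x - y)) = of_real (modulus (y - x));
  [rewrite -!norm_of_real distrC|case].
Qed.

Lemma modulusB x y : modulus (x - y) <= modulus x + modulus y.
Proof. by rewrite -ler_of_real of_realD -!norm_of_real ler_normB. Qed.

Lemma modulus_gt0 x : x != 0 -> 0 < modulus x.
Proof. by move=> x0; rewrite -ltr_of_real -norm_of_real normr_gt0. Qed.

Lemma modulus_ge0 x : 0 <= modulus x.
Proof. by rewrite -ler_of_real -norm_of_real normr_ge0. Qed.

End modulus_lemmas.

Section dense_range.
Variables (R : realType) (N : nat) (M : complexManifold R N).
Local Notation C := (Cplx R).
Variables (phi : M -> M) (hphi : holomorphic_map phi).

Lemma holomorphic_cst (a : C) : holomorphic (fun _ : M => a).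
Proof. by move=> c ac z _ zc; exact: differentiable_cst. Qed.

Lemma holomorphicD (f g : M -> C) : holomorphic f -> holomorphic g ->
  holomorphic (fun z => f z + g z).
Proof.
move=> hf hg c ac z _ zc.
by apply: differentiableD; [exact: hf|exact: hg].
Qed.

Lemma holomorphicB (f g : M -> C) : holomorphic f -> holomorphic g ->
  holomorphic (fun z => f z - g z).
Proof.
move=> hf hg c ac z _ zc.
by apply: differentiableB; [exact: hf|exact: hg].
Qed.

Lemma holomorphic_continuous (V : normedModType C) (f : M -> V) :
  holomorphic f -> continuous f.
Proof.
move=> hf z; have [c ac zc] := atlas_cover z.
have df : {for chart_map c z, continuous (f \o chart_inv c)}.
  exact: differentiable_continuous (hf c ac z I zc).
have cf : {for z, continuous ((f \o chart_inv c) \o chart_map c)}.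
  by apply: continuous_comp; [exact: chart_map_continuous|exact: df].
move=> A fA.
have H : \forall y \near z, A (f (chart_inv c (chart_map c y))).
  by apply: cf; rewrite /= chart_mapK.
have D := nbhs_chart_dom ac zc.
suff : \forall y \near z, A (f y) by [].
by apply: filterS2 H D => y + yc; rewrite chart_mapK.
Qed.

Definition dense_range := forall (g : M -> C) (K : set M) (e : R),
  holomorphic g -> compact K -> 0 < e ->
  exists2 h : M -> C, holomorphic h &
    forall z, K z -> modulus (h (phi z) - g z) < e.

(** An approximant [f \o iter n phi] lies in the range unless [n = 0]. That cannot occur both for
    [g] and for [g + e / 2]: [f] would be within [e / 4] of each, at a point where they differ by
    [e / 2]. *)
Lemma hypercyclic_dense_range : hypercyclic (comp_op hphi) -> dense_range.
Proof.
move=> /hypercyclic_approx[f hf fP] g K e hg cK e0.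
have [[z0 Kz0]|/nonemptyPn K0] := pselect (K !=set0); last first.
  by exists g => // z; rewrite K0.
have e4 : 0 < e / 4 by rewrite divr_gt0.
have pull m : holomorphic (f \o iter m phi).
  by apply: holomorphic_comp => //; exact: holomorphic_map_iter.
have [[|n] nP] := fP g K (e / 4) hg cK e4; last first.
  exists (f \o iter n phi) => // z Kz; rewrite /= -iterSr.
  by apply: lt_trans (nP z Kz) _; lra.
have hg2 := holomorphicD hg (holomorphic_cst (of_real (e / 2))).
have [[|n] mP] := fP _ K (e / 4) hg2 cK e4.
  have := nP _ Kz0; have := mP _ Kz0; rewrite /= => h1 h2.
  have := modulusB (f z0 - g z0) (f z0 - (g z0 + of_real (e / 2))).
  have -> : f z0 - g z0 - (f z0 - (g z0 + of_real (e / 2))) = of_real (e / 2).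
    by ring.
  rewrite modulus_of_real (ger0_norm (_ : 0 <= e / 2)); last by lra.
  lra.
exists (f \o iter n phi) => // z Kz; rewrite /= -iterSr.
have -> : f (iter n.+1 phi z) - g z =
  (f (iter n.+1 phi z) - (g z + of_real (e / 2))) + of_real (e / 2) by ring.
apply: le_lt_trans (modulusD _ _) _.
have := mP z Kz; rewrite modulus_of_real (ger0_norm (_ : 0 <= e / 2)); last by lra.
lra.
Qed.

Lemma dense_range_injective : stein M -> dense_range -> injective phi.
Proof.
move=> [_ _ sep _] dr z w zw; apply: contrapT => /sep[f hf fzw].
have fzw0 : 0 < modulus (f z - f w).
  by apply: modulus_gt0; rewrite subr_eq0; exact/eqP.
have cK : compact ([set z] `|` [set w]).
  by apply: compactU; exact: compact_set1.
have [h hh hP] := dr f _ _ hf cK (divr_gt0 fzw0 (ltr0n _ 2)).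
have := hP z (or_introl erefl); have := hP w (or_intror erefl).
rewrite -zw => h1 h2.
have := modulusB (h (phi z) - f w) (h (phi z) - f z).
have -> : h (phi z) - f w - (h (phi z) - f z) = f z - f w by ring.
lra.
Qed.

Lemma hypercyclic_run_away : hypercyclic (comp_op hphi) ->
  run_away (fun n => iter n phi).
Proof.
move=> /hypercyclic_approx[f hf fP] K cK.
have [K0|/nonemptyPn ->] := pselect (K !=set0); last first.
  by exists 0%N; rewrite image_set0 setI0.
have cf : {within K, continuous (fun z => modulus (f z))}.
  apply: continuous_subspaceT => z.
  apply: (@continuous_comp _ _ _ f (@modulus R)).
    exact: holomorphic_continuous.
  exact: modulus_continuous.
have [a _ amax] := compact_EVT_max K0 cK cf.
(* The constant exceeds the maximum of [|f|] on [K] by 1. With tolerance 1/2, [|f|] is above that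
   maximum on the image of [K], which therefore misses [K]. *)
have hm := holomorphic_cst (of_real (modulus (f a) + 1)).
have [|n nP] := fP _ K (2^-1) hm cK.
  by rewrite invr_gt0.
exists n; rewrite -subset0 => _ [[z Kz <-] Kn].
have := nP z Kz; have := amax _ (mem_set Kn) => /= h1 h2.
have := modulusB (f (iter n phi z))
  (f (iter n phi z) - of_real (modulus (f a) + 1)).
rewrite opprB addrCA subrr addr0 modulus_of_real ger0_norm.
  lra.
by rewrite addr_ge0 ?modulus_ge0.
Qed.

Lemma dense_range_runge : connected [set: M] -> [set: M] !=set0 ->
  dense_range -> injective phi ->
  (forall (x : M) (B : set M), nbhs x B -> nbhs (phi x) (phi @` B)) ->
  runge_domain (range phi).
Proof.
move=> cM M0 dr iphi ophi; split.
  split.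
  - rewrite openE => _ [x _ <-]; exact: ophi filterT.
  - apply: connected_continuous_connected => //.
    by apply: continuous_subspaceT; exact: hphi.1.
  - by case: M0 => x _; exists (phi x); exists x.
move=> f hf K cK Kr e e0.
have hfphi : holomorphic (f \o phi).
  move=> c ac z _ zc; have [c' ac' c'z] := atlas_cover (phi z).
  apply: (@differentiable_through_chart _ _ _ _ _ c' f
    (phi \o chart_inv c)) => //=.
  - by rewrite chart_mapK.
  - by apply: comp_chart_inv_continuous => //; exact: hphi.1.
  - by rewrite chart_mapK//; apply: hf => //; exists z.
  - exact: hphi.2.
(* [f \o phi] is holomorphic on all of [M]; approximating it by [h \o phi] on the compact preimage
   of [K] approximates [f] by [h] on [K]. *)
have cK' := compact_preimage_open_inj iphi ophi cK Kr.
have [h hh hP] := dr _ _ _ hfphi cK' e0.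
exists h => // w Kw; have [z _ zw] := Kr _ Kw.
by have := hP z; rewrite /= zw modulus_dist; apply.
Qed.

End dense_range.

(** * Injectivity of the derivative and openness *)

Section open_map.
Variables (R : realType) (N : nat) (M : complexManifold R N).
Local Notation C := (Cplx R).
Variables (phi : M -> M) (hphi : holomorphic_map phi).

Lemma diff_coord n (V : normedModType C) (F : V -> 'rV[C]_n) p i :
  differentiable F p ->
  differentiable (fun y => F y 0 i) p /\
  forall v, 'd (fun y => F y 0 i) p v = 'd F p v 0 i.
Proof.
move=> dF.
have @f : {linear 'rV[C]_n -> C}.
  by exists (fun N : 'rV[C]_n => N 0 i); do 2![eexists]; do ?[constructor];
     rewrite ?mxE// => ? *; rewrite ?mxE//; move=> ?; rewrite !mxE.
have cf : continuous f by exact: coord_continuous.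
have df y : differentiable f y by exact: linear_differentiable.
have -> : (fun y => F y 0 i) = f \o F by [].
split; first exact: differentiable_comp.
by move=> v; rewrite diff_comp// diff_lin.
Qed.

Lemma line_differentiable (V : normedModType C) (p v : V) (t : C) :
  differentiable (fun x : C => p + x *: v) t.
Proof.
apply: differentiableD; first exact: differentiable_cst.
by case: (is_diff_scalel t v).
Qed.

Lemma cderiv_line (V : normedModType C) (u : V -> C) (p v : V) :
  differentiable u p ->
  cderiv (fun x : C => u (p + x *: v)) 0 ('d u p v).
Proof.
move=> du e e0.
have v1 : 0 < `|v| + 1 by rewrite ltr_wpDl.
have ev0 : 0 < e / (`|v| + 1) by rewrite divr_gt0.
have /diff_locallyP[_ /eqaddoP /(_ _ ev0)] := du.
move=> /nbhs_normP[c /= c0 cP].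
have := near_distC_lt (0 : C) (divr_gt0 c0 v1).
apply: filterS => x; rewrite sub0r normrN => xc.
have xv : `|x *: v| <= `|x| * (`|v| + 1) by rewrite normrZ ler_wpM2l// lerDl.
have := cP (x *: v); rewrite /= sub0r normrN !fctE /= linearZ/=.
have -> : (`|x *: v| < c) = true.
  by apply: le_lt_trans xv _; rewrite -ltr_pdivlMr.
move=> /(_ isT); rewrite scale0r addr0 subr0 [x *: v + p]addrC opprD addrA.
rewrite -[x *: 'd u p v]/(x * 'd u p v) [x * _]mulrC => H.
apply: le_trans H _; apply: le_trans (_ : _ <= e / (`|v| + 1) * (`|x| * (`|v| + 1))) _.
  by rewrite ler_wpM2l// ltW.
by rewrite [`|x| * _]mulrC mulrA divfK// gt_eqF.
Qed.

Lemma square_corner_norm (s z : C) : 0 < s ->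
  square (corner s) s z -> `|z| <= 2 * s.
Proof.
move=> s0 sz; have := square_dist sz (square_corner0 s).
by rewrite subr0 (gtr0_norm s0).
Qed.

Lemma image_chart_inv c (y : 'rV[C]_N) : atlas c ->
  (chart_map c @` chart_dom c) y ->
  chart_dom c (chart_inv c y : M) /\ chart_map c (chart_inv c y) = y.
Proof. by move=> ac [z zc <-]; rewrite chart_mapK. Qed.

Lemma dense_range_diff_inj c c' (z : M) : stein M -> dense_range phi ->
  atlas c -> atlas c' -> chart_dom c z -> chart_dom c' (phi z) ->
  injective ('d (chart_map c' \o phi \o chart_inv c) (chart_map c z)).
Proof.
move=> [_ _ _ loc] dr ac ac' zc zc'.
set p := chart_map c z; set G := _ \o _.
have dG : differentiable G p by exact: hphi.2.
suff ker v : 'd G p v = 0 -> v = 0.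
  move=> v w vw; apply/eqP; rewrite -subr_eq0; apply/eqP/ker.
  by rewrite linearB /= vw subrr.
move=> Gv0; apply: contrapT => /eqP v0.
have [F hF /(_ c ac zc) bF] := loc z.
have dF : differentiable (F \o chart_inv c) p by exact: hF.
have [i Fi] : exists i, 'd (F \o chart_inv c) p v 0 i != 0.
  apply: contrapT => nex; move: v0 => /eqP; apply.
  apply: (bij_inj bF); rewrite linear0; apply/rowP => i; rewrite mxE.
  by apply: contrapT => /eqP Fi; apply: nex; exists i.
pose g (z : M) : C := F z 0 i.
have hg : holomorphic g.
  by move=> c1 ac1 z1 _ zc1; have [] := diff_coord i (hF c1 ac1 z1 I zc1).
have [dg dgE] := diff_coord i dF.
set b : C := 'd (F \o chart_inv c) p v 0 i in Fi.
have dgv : 'd (g \o chart_inv c) p v = b by exact: dgE.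
have line_c (t : C) : {for t, continuous (fun x : C => p + x *: v)}.
  exact: differentiable_continuous (line_differentiable _ _ _).
have /nbhs_normP[r /= r0 rP] : \forall t \near (0 : C),
    (chart_map c @` chart_dom c) (p + t *: v).
  apply: (line_c 0); rewrite scale0r addr0; exact: nbhs_chart_image.
have {}rP (t : C) : `|t| < r -> (chart_map c @` chart_dom c) (p + t *: v).
  by move=> tr; apply: rP; rewrite /= sub0r normrN.
(* The square of side [s] centred at 0 lies within [2 * s = r / 2] of 0, inside the part of the line
   covered by the chart. *)
pose s := r / 4.
have s0 : 0 < s by rewrite divr_gt0.
have sr (t : C) : `|t| <= 2 * s -> `|t| < r.
  move=> /le_lt_trans; apply; have -> : 2 * s = r / 2 by rewrite /s; field.
  by rewrite ltr_pdivrMr// ltr_pMr// ltr1n.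
pose K := (fun t : C => chart_inv c (p + t *: v)) @`
  [set t : C | `|t - 0| <= 2 * s].
have cK : compact K.
  apply: continuous_compact; last exact: closed_disc_compact.
  apply: continuous_in_subspaceT => t; rewrite inE /= subr0 => /sr /rP [y yc ye].
  apply: (@continuous_comp _ _ _ (fun x : C => p + x *: v) (chart_inv c)).
    exact: line_c.
  by rewrite /= -ye; exact: chart_inv_continuous.
(* Sixteen is twice the constant 8 of [cauchy_estimate], which will give
   [|b| * s <= |b| * s / 2]. *)
have bs0 : 0 < modulus (b * s) / 16.
  by rewrite divr_gt0// modulus_gt0// mulf_neq0// gt_eqF.
have [h hh hP] := dr g K _ hg cK bs0.
pose w : M -> C := fun z => g z - h (phi z).
have hhphi := holomorphic_comp hphi hh.
have hw : holomorphic w by exact: (holomorphicB hg hhphi).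
pose u : 'rV[C]_N -> C := w \o chart_inv c.
(* The term [h \o phi] contributes nothing along [v], because its derivative factors through
   ['d G p v = 0]. *)
have duv : 'd u p v = b.
  have E := diffB (hg c ac z I zc) (hhphi c ac z I zc).
  have E1 : 'd u p v =
      'd (g \o chart_inv c) p v - 'd ((h \o phi) \o chart_inv c) p v.
    exact: (congr1 (@^~ v) E).
  have d1 : chart_dom c' ((phi \o chart_inv c) p) by rewrite /= chart_mapK.
  have d2 : {for p, continuous (phi \o chart_inv c)}.
    by apply: comp_chart_inv_continuous => //; exact: hphi.1.
  have d3 : differentiable (h \o chart_inv c')
      (chart_map c' ((phi \o chart_inv c) p)).
    by move: (d1) => /= d1'; exact: (hh c' ac' _ I d1').
  have E3 := diff_through_chart ac' d1 d2 d3 dG.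
  have E2 : 'd ((h \o phi) \o chart_inv c) p v = 0.
    transitivity ('d (h \o chart_inv c') (chart_map c' ((phi \o chart_inv c) p))
      ('d G p v)); first exact: (congr1 (@^~ v) E3).
    by rewrite Gv0; exact: linear0.
  apply: (etrans E1); apply: (etrans (congr1 (fun y => y - _) dgv)).
  by apply: (etrans (congr1 (fun y => b - y) E2)); exact: subr0.
have du (t : C) : `|t| < r -> differentiable u (p + t *: v).
  by move=> /rP[y yc <-]; exact: hw.
have := cderiv_line v (hw c ac z I zc); rewrite -/u duv => cb.
have b16 : of_real (modulus (b * s) / 16) = `|b| * s / 16.
  by rewrite of_realM of_realV of_real_nat -norm_of_real normrM (gtr0_norm s0).
have : `|b| * s <= 8 * (`|b| * s / 16).
  apply: (cauchy_estimate s0 _ _ cb) => t /(square_corner_norm s0) ts.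
    have tr := sr _ ts.
    apply: (@differentiable_comp _ _ _ _ (fun x : C => p + x *: v) u).
      exact: line_differentiable.
    exact: du.
  rewrite -b16 norm_of_real ler_of_real /u /w /= modulus_dist ltW//.
  by apply: hP; exists t => //=; rewrite subr0.
have -> : 8 * (`|b| * s / 16) = `|b| * s / 2 by field.
rewrite ler_pdivlMr// -subr_le0.
have -> : `|b| * s * 2 - `|b| * s = `|b| * s by ring.
by rewrite pmulr_lle0// normr_le0; apply/negP.
Qed.

Lemma dense_range_open : stein M -> dense_range phi -> injective phi ->
  forall (x : M) (B : set M), nbhs x B -> nbhs (phi x) (phi @` B).
Proof.
move=> sM dr iphi x B Bx.
have [c ac xc] := atlas_cover x; have [c' ac' xc'] := atlas_cover (phi x).
set p := chart_map c x; pose G := chart_map c' \o phi \o chart_inv c.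
have H1 := nbhs_chart_image ac xc.
have H2 := nbhs_chart_inv ac xc Bx.
have H3 : \forall y \near chart_map c x, chart_dom c' (phi (chart_inv c y)).
  apply: (nbhs_chart_inv ac xc (A := phi @^-1` chart_dom c')).
  exact: hphi.1 (nbhs_chart_dom ac' xc').
have /nbhs_normP[r /= r0 rP] : \forall y \near p,
    [/\ (chart_map c @` chart_dom c) y, B (chart_inv c y) &
        chart_dom c' (phi (chart_inv c y))].
  by apply: filterS3 H1 H2 H3 => y.
have r20 : 0 < r / 2 by rewrite divr_gt0.
have {}rP (y : 'rV[C]_N) : `|y - p| <= r / 2 ->
    [/\ (chart_map c @` chart_dom c) y, B (chart_inv c y) &
        chart_dom c' (phi (chart_inv c y))].
  move=> yr; apply: rP; rewrite /= distrC (le_lt_trans yr)//.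
  by rewrite ltr_pdivrMr// ltr_pMr// ltr1n.
have Gp : G p = chart_map c' (phi x) by rewrite /G /= chart_mapK.
have : nbhs (G p) (G @` [set y | `|y - p| <= r / 2]).
  apply: local_open_image => //.
    move=> y /rP[/(image_chart_inv ac)[yc ye] _ yc'].
    rewrite -ye; split; first exact: hphi.2.
    exact: dense_range_diff_inj.
  move=> y /rP[/(image_chart_inv ac)[yc ye] _ yc'] Gy.
  rewrite -ye /p; congr chart_map; apply: iphi.
  move: Gy; rewrite Gp /G /= => Gy.
  by rewrite -(chart_mapK ac' yc') Gy chart_mapK.
rewrite Gp => /(chart_map_continuous ac' xc') H.
have H' : \forall w \near phi x,
    (G @` [set y | `|y - p| <= r / 2]) (chart_map c' w) by [].
apply: filterS2 H' (nbhs_chart_dom ac' xc') => w [y /rP[_ By yc'] Gy] wc'.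
exists (chart_inv c y) => //.
move: Gy; rewrite /G /= => Gy.
by rewrite -(chart_mapK ac' yc') Gy chart_mapK.
Qed.

End open_map.

(** * Taut manifolds *)

Section taut.
Variables (R : realType) (N : nat) (M : complexManifold R N).
Local Notation C := (Cplx R).
Variables (phi : M -> M) (hphi : holomorphic_map phi).

Lemma discE (t : C) : disc R t <-> `|t| < 1.
Proof. by rewrite norm_of_real -[1]/(of_real 1) ltr_of_real. Qed.

Lemma disc_open : open (disc R).
Proof.
rewrite (_ : disc R = @modulus R @^-1` [set x | x < 1])//.
by apply: open_comp; [move=> t _; exact: modulus_continuous|exact: open_lt].
Qed.

Definition half_disc : set C := [set t | `|t - 0| <= 2^-1].

Lemma half_disc_compact : compact half_disc.
Proof. exact: closed_disc_compact. Qed.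

Lemma half_disc_sub : half_disc `<=` disc R.
Proof.
move=> t; rewrite /half_disc /= subr0 => t2; apply/discE.
by apply: le_lt_trans t2 _; rewrite invf_lt1// ltr1n.
Qed.

Lemma uniform_cvg_near (V : normedModType C) (K : set C) (G : nat -> C -> V)
    (g : C -> V) (e : C) : 0 < e -> {uniform K, G @ \oo --> g} ->
  \forall n \near \oo, forall t, K t -> `|g t - G n t| < e.
Proof.
move=> e0 cvgG.
pose E := [set xy : V * V | `|xy.1 - xy.2| < e].
have : nbhs (g : {uniform` K -> V}) [set h | forall y, K y -> E (g y, h y)].
  apply/uniform_nbhs; exists E; split => //.
  rewrite -entourage_ballE; exists e => //=.
  by move=> [x y] /=; rewrite -ball_normE.
by move=> /cvgG.
Qed.

Lemma holomorphic_image_closed (V : normedModType C) (F : M -> V) (A : set M) :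
  holomorphic F -> compact A -> closed (F @` A).
Proof.
move=> hF cA; apply: compact_closed; first exact: norm_hausdorff.
apply: (continuous_compact _ cA); apply: continuous_subspaceT.
exact: holomorphic_continuous.
Qed.

(** [F] is a homeomorphism onto its image: by properness, the points over [B] outside [W] form a
    compact set, whose image is closed and misses [F x]. *)
Lemma proper_embedding_nbhs (V : normedModType C) (F : M -> V) (x : M)
    (W : set M) (B : set V) :
  proper_embedding F -> open W -> W x -> compact B -> nbhs (F x) B ->
  \forall y \near F x, forall z, F z = y -> W z.
Proof.
move=> [hF iF _ pF] oW Wx cB Bx.
pose A := F @^-1` B `&` ~` W.
have cA : compact A by apply: compact_closedI; [exact: pF|exact: open_closedC].
have clFA : closed (F @` A) by exact: holomorphic_image_closed.
have nFA : nbhs (F x) (~` (F @` A)).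
  apply: open_nbhs_nbhs; split; first exact: closed_openC.
  by move=> [z [_ nW] /iF zx]; apply: nW; rewrite zx.
apply: filterS2 Bx nFA => y By nAy z zy.
apply: contrapT => nW; apply: nAy; exists z => //; split => //.
by rewrite /= zy.
Qed.

(** Let [x_i] tend to [y] with [phi^(q_i) (x_i)] in [L]. The disc [u i] takes the value
    [phi^(q_i) (y)] at 0 and [phi^(q_i) (x_i)] at [t i]. Meeting [L], these discs do not diverge
    compactly; a limit disc [f] has [f 0] in [L] as [t i] tends to 0, so some [phi^(q_i) (y)] lies
    in [W]. *)
Lemma taut_iter_near (y : M) (L W : set M) (Q : set nat) : taut M ->
  compact L -> open W -> L `<=` W ->
  (forall U, nbhs y U -> exists q x, [/\ Q q, U x & L (iter q phi x)]) ->
  exists2 q, Q q & W (iter q phi y).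
Proof.
move=> tM cL oW LW H.
have [c ac yc] := atlas_cover y; set p := chart_map c y.
have /nbhs_normP[r /= r0 rP] : \forall x \near p, (chart_map c @` chart_dom c) x.
  exact: nbhs_chart_image.
have {}rP (x : 'rV[C]_N) : `|x| < r -> (chart_map c @` chart_dom c) (p + x).
  by move=> xr; apply: rP; rewrite /= opprD addrA subrr sub0r normrN.
(* Starting from 1/2 keeps every [t i] in [half_disc]. *)
pose t (i : nat) : C := i.+2%:R^-1.
have t0 i : 0 < t i by rewrite invr_gt0.
have [g gP] : exists g : nat -> nat * M, forall i, [/\ Q (g i).1,
    chart_dom c (g i).2, `|chart_map c (g i).2 - p| < r * t i &
    L (iter (g i).1 phi (g i).2)].
  suff /choice[g gP] : forall i, exists g : nat * M, [/\ Q g.1,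
    chart_dom c g.2, `|chart_map c g.2 - p| < r * t i & L (iter g.1 phi g.2)].
    by exists g.
  move=> i.
  have rt0 : 0 < r * t i by rewrite mulr_gt0.
  have D := near_dist_lt p rt0.
  have D' : \forall x \near y, `|p - chart_map c x| < r * t i.
    exact: (chart_map_continuous ac yc D).
  have [q [x [Qq [xc xp] Lx]]] := H _ (filterI (nbhs_chart_dom ac yc) D').
  by exists (q, x); split => //=; rewrite distrC.
(* Rescaled so that the line from [p] reaches the chosen point at parameter [t i]; the bound
   [r * t i] keeps the unit disc inside the chart. *)
pose w i := (t i)^-1 *: (chart_map c (g i).2 - p).
have wr i : `|w i| < r.
  have [_ _ gr _] := gP i.
  by rewrite normrZ normfV (gtr0_norm (t0 i)) mulrC ltr_pdivrMr.
have lwr i (s : C) : `|s| < 1 -> `|s *: w i| < r.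
  move=> s1; rewrite normrZ; apply: le_lt_trans (wr i).
  by rewrite ler_piMl// ltW.
pose u i (s : C) := iter (g i).1 phi (chart_inv c (p + s *: w i)).
have hu i : holomorphic_disc (u i).
  have [cit dit] := holomorphic_map_iter (g i).1 hphi.
  split.
    apply: continuous_in_subspaceT => s.
    rewrite inE => /discE /(lwr i) /rP[x xc xE].
    apply: (@continuous_comp _ _ _ (fun s : C => p + s *: w i)
      (iter (g i).1 phi \o chart_inv c)).
      exact: differentiable_continuous (line_differentiable _ _ _).
    by rewrite /= -xE; exact: comp_chart_inv_continuous.
  move=> c' ac' s /discE /(lwr i) /rP[x xc xE] uc'.
  apply: (@differentiable_comp _ _ _ _ (fun s : C => p + s *: w i)
    (chart_map c' \o iter (g i).1 phi \o chart_inv c)).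
    exact: line_differentiable.
  by rewrite -xE; apply: dit => //; move: uc'; rewrite /u -xE chart_mapK.
have ut i : u i (t i) = iter (g i).1 phi (g i).2.
  have [_ gc _ _] := gP i.
  by rewrite /u /w scalerA divff ?gt_eqF// scale1r addrC subrK chart_mapK.
have u0 i : u i 0 = iter (g i).1 phi y.
  by rewrite /u scale0r addr0 chart_mapK.
have Lut i : L (u i (t i)) by rewrite ut; have [] := gP i.
have thalf i : half_disc (t i).
  by rewrite /half_disc /= subr0 gtr0_norm// lef_pV2 ?posrE// ler_nat.
case: (tM u hu) => [/(_ _ _ half_disc_compact half_disc_sub cL)[n0]|].
  move=> /(_ n0 (leqnn _)).
  move=> e0; exfalso; move: e0; apply/eqP/set0P.
  by exists (u n0 (t n0)); split => //; exists (t n0).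
move=> [k [f [ik [cf _] [F pF cvgF]]]].
have {}cvgF := cvgF _ half_disc_compact half_disc_sub.
have [hF iF _ properF] := pF.
have cF : continuous F := holomorphic_continuous hF.
have D0 : disc R (0 : C) by apply/discE; rewrite normr0.
have cf0 : {for 0, continuous f}.
  move: cf; rewrite continuous_open_subspace; first by apply; rewrite inE.
  exact: disc_open.
have cFf : {for 0, continuous (F \o f)}.
  by apply: continuous_comp; [exact: cf0|exact: cF].
have Lf : L (f 0).
  suff [x Lx /iF <-] : (F @` L) (F (f 0)) by [].
  have clFL := holomorphic_image_closed hF cL.
  apply: contrapT => nFL.
  have /nbhs_normP[e /= e0 eP] : nbhs (F (f 0)) (~` (F @` L)).
    by apply: open_nbhs_nbhs; split => //; exact: closed_openC.
  have e20 : 0 < e / 2 by rewrite divr_gt0.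
  have /nbhs_normP[d /= d0 dP] : \forall s \near (0 : C),
      `|F (f 0) - F (f s)| < e / 2.
    exact: (cFf _ (near_dist_lt (F (f 0)) e20)).
  have [n1 n1d] := exists_invS_lt d0.
  have [n2 _ n2P] := uniform_cvg_near e20 cvgF.
  pose n := (n1 + n2)%N.
  have nd : `|t (k n)| < d.
    rewrite gtr0_norm//; apply: le_lt_trans n1d.
    rewrite lef_pV2 ?posrE// ler_nat ltnS.
    by apply: leq_trans (leqW (increasing_geq ik n)); exact: leq_addr.
  apply: (eP (F (u (k n) (t (k n))))); last by exists (u (k n) (t (k n))).
  rewrite /= -(subrK (F (f (t (k n)))) (F (f 0))) -addrA.
  apply: le_lt_trans (ler_normD _ _) _.
  rewrite [e]splitr ltrD//.
    by apply: dP; rewrite /= sub0r normrN.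
  by apply: n2P => //; exact: leq_addl.
have cB : compact [set x | `|x - F (f 0)| <= 1] by exact: rV_closed_ball_compact.
have Bf : nbhs (F (f 0)) [set x | `|x - F (f 0)| <= 1].
  have := near_dist_lt (F (f 0)) ltr01.
  by apply: filterS => x /= /ltW; rewrite distrC.
have /nbhs_normP[e /= e0 eP] := proper_embedding_nbhs pF oW (LW _ Lf) cB Bf.
have [n _ nP] := uniform_cvg_near e0 cvgF.
exists (g (k n)).1; first by have [] := gP (k n).
rewrite -u0; apply: (eP (F (u (k n) 0))) => //=.
apply: (nP n (leqnn _)).
by rewrite /half_disc /= subrr normr0 invr_ge0.
Qed.

Lemma taut_prolongation_omega x w : stein M -> taut M ->
  prolongation_limit phi x w -> omega_limit phi x w.
Proof.
move=> sM tM xw W m Ww.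
have [V cV Vw] := stein_locally_compact sM w.
(* Regularity shrinks [W] to a compact neighbourhood of [w], which serves as the set [L] of
   [taut_iter_near]. *)
have reg := compact_regular (@mfd_hausdorff _ _ M) cV Vw.
have [B Bw BW] := reg _ (nbhs_interior Ww).
have cL : compact (V `&` closure B).
  by apply: compact_closedI => //; exact: closed_closure.
have Lw : nbhs w (V `&` closure B).
  by apply: filterI => //; apply: filterS Bw; exact: subset_closure.
have [|||q mq Wq] := @taut_iter_near x _ W^° [set q | (m <= q)%N] tM cL.
- exact: open_interior.
- by move=> z [_ /BW].
- by move=> U Ux; have [q [z [mq Uz Lz]]] := xw _ _ m Ux Lw; exists q, z.
by exists q; split => //; exact: interior_subset Wq.
Qed.

End taut.

Theorem theorem5p2 (R : realType) (N : nat) (Omega : complexManifold R N)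
    (phi : Omega -> Omega) (hphi : holomorphic_map phi) :
  class_S Omega -> taut Omega ->
  hypercyclic (comp_op hphi) -> hereditarily_hypercyclic (comp_op hphi).
Proof.
move=> [sO cO S] tO hyp k ik.
(* A Runge domain is nonempty, so the empty manifold is treated apart: there the function space has
   a single point. *)
have [ne|ne] := pselect ([set: Omega] !=set0); last first.
  case: hyp => f _; exists f => A [a Aa] _; exists a; split => //.
  exists 0%N => //; apply: val_inj; apply/funext => z.
  by exfalso; apply: ne; exists z.
have dr := hypercyclic_dense_range hyp.
have iphi := dense_range_injective sO dr.
have ophi := dense_range_open hphi sO dr iphi.
(* The defining property of the class is applied to [k] itself, which leaves run-away along [k] to
   be proved. *)
apply: S => //; first exact: dense_range_runge.
apply: run_away_subsequence => //.
- exact: hphi.1.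
- exact: stein_locally_compact.
- by move=> x w; exact: taut_prolongation_omega.
- exact: hypercyclic_run_away hyp.
Qed.
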